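(* Let $\mathcal{M},\mathcal{N}$ be von Neumann algebras and let $\Phi,\Psi\in\mathrm{CP}(\mathcal{M},\mathcal{N})$. Then \[ \Phi\,!\,\Psi\le_{\mathrm{cp}}\Phi\#\Psi\le_{\mathrm{cp}}\Phi\nabla\Psi . \]
   Context: $\mathrm{CP}(\mathcal{M},\mathcal{N})$ is the set of all completely positive (CP) maps $\mathcal{M}\to\mathcal{N}$ (not assumed normal). $\Phi\le_{\mathrm{cp}}\Psi$ means $\Psi-\Phi$ is CP. Forms: for a complex vector space $\mathcal{V}$, $F_+(\mathcal{V})$ is the set of positive sesquilinear forms on $\mathcal{V}$ (linear in the first variable). A compatible representation of $\alpha,\beta\in F_+(\mathcal{V})$ consists of a linear map $h$ from $\mathcal{V}$ onto a dense subspace of a Hilbert space $\mathcal{H}$ and commuting positive $A,B\in\mathbb{B}(\mathcal{H})$ with $\alpha(x,y)=\langle Ah(x),h(y)\rangle$, $\beta(x,y)=\langle Bh(x),h(y)\rangle$. By Pusz–Woronowicz such representations always exist, and for a homogeneous locally bounded Borel function $f$ on $[0,\infty)^2$ the form $f(\alpha,\beta)(x,y):=\langle f(A,B)h(x),h(y)\rangle$ does not depend on the choice. The geometric mean $\alpha\#\beta$ and parallel sum $\alpha:\beta$ are $f(\alpha,\beta)$ for $f(r,s)=\sqrt{rs}$ and $f(r,s)=\frac{rs}{r+s}$ (with $0/0=0$), respectively. CP maps: $L^2(\mathcal{N})$ is the standard form Hilbert space of $\mathcal{N}$. For $\Phi\in\mathrm{CP}(\mathcal{M},\mathcal{N})$,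 $s_\Phi$ is the positive sesquilinear form on the algebraic tensor product $\mathcal{M}\odot L^2(\mathcal{N})$ given by $s_\Phi(x\otimes\xi,y\otimes\eta)=\langle\Phi(y^*x)\xi,\eta\rangle$. The geometric mean $\Phi\#\Psi$ and parallel sum $\Phi:\Psi$ in $\mathrm{CP}(\mathcal{M},\mathcal{N})$ are the unique CP maps with $\langle(\Phi\#\Psi)(y^*x)\xi,\eta\rangle=(s_\Phi\#s_\Psi)(x\otimes\xi,y\otimes\eta)$ and $\langle(\Phi:\Psi)(y^*x)\xi,\eta\rangle=(s_\Phi:s_\Psi)(x\otimes\xi,y\otimes\eta)$ for all $x,y\in\mathcal{M}$, $\xi,\eta\in L^2(\mathcal{N})$. The harmonic mean is $\Phi\,!\,\Psi:=2(\Phi:\Psi)$ and the arithmetic mean is $\Phi\nabla\Psi:=\frac{\Phi+\Psi}{2}$. *)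

(* Defs.v *)
From HB Require Import structures.
From mathcomp Require Import all_boot all_order all_algebra sesquilinear.
From mathcomp Require Import all_classical all_reals all_analysis.
From mathcomp.real_closed Require Import complex.

Set Implicit Arguments.
Unset Strict Implicit.
Unset Printing Implicit Defensive.

Import Order.TTheory GRing.Theory Num.Theory numFieldNormedType.Exports.
Local Open Scope classical_set_scope.
Local Open Scope ring_scope.
Local Open Scope complex_scope.

(* The scalars are C = R[i], where R : realType is the field of reals. *)

(* {dot H for conjc}: sesquilinear (linear in the first variable), Hermitian
   and positive definite. *)
HB.mixin Record isHilbert (R : realType) H of CompleteNormedModule R[i] H := {
  hdot : {dot H for @conjc R} ;
  hnormE : forall x : H, `|x| ^+ 2 = hdot x x
}.

#[short(type="hilbertType")]
HB.structure Definition Hilbert (R : realType) :=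
  {H of CompleteNormedModule R[i] H & isHilbert R H}.

Notation "''[' x , y ]" := (hdot x y) : ring_scope.

Section Operators.
Variables (R : realType) (H : hilbertType R).
Implicit Types (S T : H -> H) (A : set (H -> H)).

Lemma hdot_inj (x y : H) : (forall w : H, '[w, x] = '[w, y]) -> x = y.
Proof.
move=> e; apply: subr0_eq; apply/normr0_eq0/eqP.
by rewrite -sqrf_eq0 hnormE linearBr /= e subrr.
Qed.

Definition bounded_op T := linear T /\ continuous T.

Definition is_adjoint T S := forall x y : H, '[T x, y] = '[x, S y].

Definition positive_op T := forall x : H, 0 <= '[T x, x].

Definition commutant A : set (H -> H) :=
  [set T | bounded_op T /\ forall S, A S -> T \o S = S \o T].

End Operators.

(* A von Neumann algebra on H: a unital *-subalgebra of B(H) equal to its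
   bicommutant.  The inclusion in the bicommutant is automatic. *)
Record vnAlgebra (R : realType) (H : hilbertType R) := VNAlgebra {
  vn_pred : {pred H -> H} ;
  vn_bounded : forall T, T \in vn_pred -> bounded_op T ;
  vn_one : idfun \in vn_pred ;
  vn_submod : submod_closed vn_pred ;
  vn_comp : forall S T, S \in vn_pred -> T \in vn_pred -> S \o T \in vn_pred ;
  vn_adj : forall T, T \in vn_pred ->
    exists S, S \in vn_pred /\ is_adjoint T S ;
  vn_bicommutant : commutant (commutant [set` vn_pred]) `<=` [set` vn_pred]
}.

HB.instance Definition _ (R : realType) (H : hilbertType R)
    (M : vnAlgebra H) :=
  GRing.isSubmodClosed.Build R[i] (H -> H) (vn_pred M) (vn_submod M).

Record vn_sort (R : realType) (H : hilbertType R) (M : vnAlgebra H) :=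
  VNElt { vn_op :> H -> H ; vn_opP : vn_op \in vn_pred M }.

Coercion vn_sort : vnAlgebra >-> Sortclass.

Section VNSort.
Variables (R : realType) (H : hilbertType R) (M : vnAlgebra H).

HB.instance Definition _ := [isSub for @vn_op R H M].
HB.instance Definition _ := [Choice of vn_sort M by <:].
HB.instance Definition _ := [SubChoice_isSubLmodule of vn_sort M by <:].

Definition vn_id : M := VNElt (vn_one M).

Definition vn_mul (x y : M) : M := VNElt (vn_comp (vn_opP x) (vn_opP y)).

Definition vn_star (x : M) : M :=
  VNElt (proj1 (projT2 (cid (vn_adj (vn_opP x))))).

Lemma vn_starP (x : M) : is_adjoint x (vn_star x).
Proof. exact: (proj2 (projT2 (cid (vn_adj (vn_opP x))))). Qed.

#[global] Arguments vn_star : simpl never.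

(* Positive elements of the *-algebra M_n(M): those of the form b^* b. *)
Definition mx_positive n (a : 'M[M]_n) :=
  exists b : 'M[M]_n,
    forall i j, a i j = \sum_k vn_mul (vn_star (b k i)) (b k j).

End VNSort.

Section CP.
Variables (R : realType) (H K : hilbertType R).
Variables (M : vnAlgebra H) (N : vnAlgebra K).

Definition CP : set (M -> N) :=
  [set Phi | linear Phi /\
     forall n (a : 'M[M]_n), mx_positive a -> mx_positive (map_mx Phi a)].

Definition cp_le (Phi Psi : M -> N) := CP (fun x => Psi x - Phi x).

End CP.

(* A standard form in Haagerup's sense: L2_rep is a *-isomorphism of N onto a
   von Neumann algebra on L2 (hence automatically normal), L2_J the modular
   conjugation and L2_cone the self-dual cone.  Every von Neumann algebra has
   one, unique up to unitary equivalence. *)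
Record standardForm (R : realType) (K : hilbertType R) (N : vnAlgebra K) :=
  StandardForm {
  L2 : hilbertType R ;
  L2_rep : N -> L2 -> L2 ;
  L2_rep_linear : linear L2_rep ;
  L2_rep_bounded : forall a, bounded_op (L2_rep a) ;
  L2_rep_one : L2_rep (vn_id N) = idfun ;
  L2_rep_mul : forall a b, L2_rep (vn_mul a b) = L2_rep a \o L2_rep b ;
  L2_rep_star : forall a, is_adjoint (L2_rep a) (L2_rep (vn_star a)) ;
  L2_rep_inj : injective L2_rep ;
  L2_rep_bicommutant : commutant (commutant (range L2_rep)) = range L2_rep ;
  L2_J : L2 -> L2 ;
  L2_J_antilinear : forall (c : R[i]) x y,
    L2_J (c *: x + y) = c^* *: L2_J x + L2_J y ;
  L2_J_isometry : forall x y, '[L2_J x, L2_J y] = '[y, x] ;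
  L2_J_involutive : involutive L2_J ;
  L2_cone : set L2 ;
  L2_cone_selfdual : L2_cone = [set x | forall y, L2_cone y -> 0 <= '[x, y]] ;
  L2_J_commutant :
    [set L2_J \o T \o L2_J | T in range L2_rep] = commutant (range L2_rep) ;
  L2_J_center : forall c, commutant (range L2_rep) (L2_rep c) ->
    L2_J \o L2_rep c \o L2_J = L2_rep (vn_star c) ;
  L2_J_cone : forall x, L2_cone x -> L2_J x = x ;
  L2_rep_cone : forall a x, L2_cone x ->
    L2_cone (L2_rep a (L2_J (L2_rep a (L2_J x))))
}.

Arguments L2_rep {R K N} L _ _ : rename.
Arguments L2_J {R K N} L _ : rename.
Arguments L2_cone {R K N} L _ : rename.

(* Elements are finite formal sums of pure tensors, given as lists of pairs,
   modulo the congruence below; scalars are absorbed in the first factor. *)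
Section Tensor.
Variables (C : comNzRingType) (U V : lmodType C).
Implicit Types (s t : seq (U * V)) (x : U) (y : V) (c : C).

Inductive tensor_rel : seq (U * V) -> seq (U * V) -> Prop :=
| tensor_refl s : tensor_rel s s
| tensor_sym s t : tensor_rel s t -> tensor_rel t s
| tensor_trans t s u : tensor_rel s t -> tensor_rel t u -> tensor_rel s u
| tensor_cat s s' t t' :
    tensor_rel s s' -> tensor_rel t t' -> tensor_rel (s ++ t) (s' ++ t')
| tensor_catC s t : tensor_rel (s ++ t) (t ++ s)
| tensor_Dl x x' y : tensor_rel [:: (x + x', y)] [:: (x, y); (x', y)]
| tensor_Dr x y y' : tensor_rel [:: (x, y + y')] [:: (x, y); (x, y')]
| tensor_Zr c x y : tensor_rel [:: (c *: x, y)] [:: (x, c *: y)]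
| tensor_0l y : tensor_rel [:: (0, y)] [::].

Definition tensor_eqb s t := `[< tensor_rel s t >].

Lemma tensor_eqbP : equiv_class_of tensor_eqb.
Proof.
split.
- by move=> s; apply/asboolP; exact: tensor_refl.
- by move=> s t; apply/asboolP/asboolP; exact: tensor_sym.
- by move=> t s u /asboolP st /asboolP tu; apply/asboolP; exact: tensor_trans tu.
Qed.

Canonical tensor_equiv := EquivRelPack tensor_eqbP.

Definition tensor : Type := {eq_quot tensor_equiv}%qT.
HB.instance Definition _ := Choice.on tensor.
HB.instance Definition _ := Quotient.on tensor.

Definition tclass s : tensor := (\pi_tensor s)%qT.
Definition trepr (u : tensor) : seq (U * V) := (repr u)%qT.

Definition tpure x y : tensor := tclass [:: (x, y)].

Lemma tclassK u : tclass (trepr u) = u.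
Proof. exact: reprK. Qed.

Lemma tclassP s t : tclass s = tclass t <-> tensor_rel s t.
Proof.
split; first by move/eqmodP/asboolP.
by move=> st; apply/eqmodP/asboolP.
Qed.

Lemma trepr_rel s : tensor_rel (trepr (tclass s)) s.
Proof. by apply/tclassP; rewrite tclassK. Qed.

Definition tensor_add u v := tclass (trepr u ++ trepr v).
Definition tensor_opp u := tclass [seq (- p.1, p.2) | p <- trepr u].
Definition tensor_scale c u := tclass [seq (c *: p.1, p.2) | p <- trepr u].

Lemma tclass_add s t : tclass (s ++ t) = tensor_add (tclass s) (tclass t).
Proof.
by apply/tclassP/tensor_cat; apply: tensor_sym; exact: trepr_rel.
Qed.

Lemma map_rel (f : {linear U -> U}) s t : tensor_rel s t ->
  tensor_rel [seq (f p.1, p.2) | p <- s] [seq (f p.1, p.2) | p <- t].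
Proof.
elim=> {s t} /=.
- by move=> s; exact: tensor_refl.
- by move=> s t _; exact: tensor_sym.
- by move=> t s u _ st _; exact: tensor_trans.
- by move=> s s' t t' _ ss' _ tt'; rewrite !map_cat; exact: tensor_cat.
- by move=> s t; rewrite !map_cat; exact: tensor_catC.
- by move=> x x' y; rewrite linearD; exact: tensor_Dl.
- by move=> x y y'; exact: tensor_Dr.
- by move=> c x y; rewrite linearZ; exact: tensor_Zr.
- by move=> y; rewrite linear0; exact: tensor_0l.
Qed.

Lemma tclass_opp s : tensor_opp (tclass s) = tclass [seq (- p.1, p.2) | p <- s].
Proof. by apply/tclassP/(map_rel (-%R : {linear U -> U}))/trepr_rel. Qed.

Lemma tclass_scale c s :
  tensor_scale c (tclass s) = tclass [seq (c *: p.1, p.2) | p <- s].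
Proof. by apply/tclassP/(map_rel ( *:%R c : {linear U -> U}))/trepr_rel. Qed.

Lemma tensor_addA : associative tensor_add.
Proof.
move=> u v w; rewrite -[u]tclassK -[v]tclassK -[w]tclassK.
by rewrite -!tclass_add catA.
Qed.

Lemma tensor_addC : commutative tensor_add.
Proof.
move=> u v; rewrite -[u]tclassK -[v]tclassK -!tclass_add.
exact/tclassP/tensor_catC.
Qed.

Lemma tensor_add0 : left_id (tclass [::]) tensor_add.
Proof. by move=> u; rewrite -[u]tclassK -tclass_add. Qed.

Lemma tensor_addN : left_inverse (tclass [::]) tensor_opp tensor_add.
Proof.
move=> u; rewrite -[u]tclassK tclass_opp -tclass_add; apply/tclassP.
elim: (trepr u) => [|[x y] s IH] /=; first exact: tensor_refl.
rewrite -cat1s -[(x, y) :: s]cat1s.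
apply: (@tensor_trans (([:: (- x, y)] ++ [:: (x, y)]) ++
   ([seq (- p.1, p.2) | p <- s] ++ s))).
  rewrite -!catA; apply: tensor_cat; first exact: tensor_refl.
  rewrite !catA; apply: tensor_cat; last exact: tensor_refl.
  exact: tensor_catC.
rewrite -[[::]]cat0s; apply: tensor_cat => //.
apply: tensor_trans (tensor_sym (tensor_Dl _ _ _)) _.
by rewrite addNr; exact: tensor_0l.
Qed.

HB.instance Definition _ :=
  GRing.isZmodule.Build tensor tensor_addA tensor_addC tensor_add0 tensor_addN.

Lemma tensor_scaleA a b u :
  tensor_scale a (tensor_scale b u) = tensor_scale (a * b) u.
Proof.
rewrite -[u]tclassK !tclass_scale -map_comp; congr tclass.
by apply: eq_map => p /=; rewrite scalerA.
Qed.

Lemma tensor_scale1 : left_id 1 tensor_scale.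
Proof.
move=> u; rewrite -[RHS]tclassK -[u in LHS]tclassK tclass_scale; congr tclass.
by rewrite -[RHS]map_id; apply: eq_map => -[x y] /=; rewrite scale1r.
Qed.

Lemma tensor_scaleDr : right_distributive tensor_scale +%R.
Proof.
move=> c u v; rewrite -[u]tclassK -[v]tclassK /GRing.add /=.
by rewrite -tclass_add !tclass_scale map_cat tclass_add.
Qed.

Lemma tensor_scaleDl u : {morph tensor_scale^~ u : a b / a + b}.
Proof.
move=> a b; rewrite -[u]tclassK !tclass_scale /GRing.add /= -tclass_add.
apply/tclassP; elim: (trepr u) => [|[x y] s IH] /=; first exact: tensor_refl.
rewrite -cat1s -[_ :: _ ++ _]cat1s -[(b *: x, y) :: _]cat1s.
apply: (@tensor_trans (([:: (a *: x, y)] ++ [:: (b *: x, y)]) ++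
   ([seq (a *: p.1, p.2) | p <- s] ++ [seq (b *: p.1, p.2) | p <- s]))).
  by rewrite scalerDl; apply: tensor_cat => //; exact: tensor_Dl.
rewrite -!catA; apply: tensor_cat; first exact: tensor_refl.
rewrite !catA; apply: tensor_cat; last exact: tensor_refl.
exact: tensor_catC.
Qed.

HB.instance Definition _ := GRing.Zmodule_isLmodule.Build C tensor
  tensor_scaleA tensor_scale1 tensor_scaleDr tensor_scaleDl.

Lemma tclass_sum s : tclass s = \sum_(p <- s) tpure p.1 p.2.
Proof.
elim: s => [|[x y] s IH]; first by rewrite big_nil.
by rewrite big_cons -IH -cat1s tclass_add.
Qed.

Lemma tpureDl x x' y : tpure (x + x') y = tpure x y + tpure x' y.
Proof.
by apply: etrans (tclass_add _ _); apply/tclassP; exact: tensor_Dl.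
Qed.

Lemma tpureDr x y y' : tpure x (y + y') = tpure x y + tpure x y'.
Proof.
by apply: etrans (tclass_add _ _); apply/tclassP; exact: tensor_Dr.
Qed.

Lemma tpureZl c x y : tpure (c *: x) y = c *: tpure x y.
Proof. by rewrite [RHS]tclass_scale. Qed.

Lemma tpureZr c x y : tpure x (c *: y) = c *: tpure x y.
Proof. by rewrite -tpureZl; apply/tclassP/tensor_sym; exact: tensor_Zr. Qed.

Definition tlift (W : lmodType C) (b : U -> V -> W) (u : tensor) : W :=
  \sum_(p <- trepr u) b p.1 p.2.

Section Lift.
Variables (W : lmodType C) (b : U -> V -> W).
Hypothesis bl : forall y, linear (b^~ y).
Hypothesis br : forall x, linear (b x).

Lemma tlift_class s : tlift b (tclass s) = \sum_(p <- s) b p.1 p.2.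
Proof.
have bDl x x' y : b (x + x') y = b x y + b x' y.
  by have := bl y 1 x x'; rewrite !scale1r.
have bDr x y y' : b x (y + y') = b x y + b x y'.
  by have := br x 1 y y'; rewrite !scale1r.
have b0l y : b 0 y = 0.
  by apply: (addrI (b 0 y)); rewrite addr0 -bDl addr0.
have b0r x : b x 0 = 0.
  by apply: (addrI (b x 0)); rewrite addr0 -bDr addr0.
have bZ c x y : b (c *: x) y = b x (c *: y).
  by have := bl y c x 0; have := br x c y 0; rewrite !addr0 b0l b0r !addr0 => -> ->.
rewrite /tlift; move: (trepr _) (trepr_rel s) => s'; elim=> {s s'} //=.
- by move=> t u v _ -> _ ->.
- by move=> s1 s2 t1 t2 _ E1 _ E2; rewrite !big_cat /= E1 E2.
- by move=> s1 s2; rewrite !big_cat /= addrC.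
- by move=> x x' y; rewrite !big_cons !big_nil /= !addr0 bDl.
- by move=> x y y'; rewrite !big_cons !big_nil /= !addr0 bDr.
- by move=> c x y; rewrite !big_seq1 /= bZ.
- by move=> y; rewrite big_seq1 big_nil /= b0l.
Qed.

Lemma tlift_pure x y : tlift b (tpure x y) = b x y.
Proof. by rewrite tlift_class big_seq1. Qed.

Lemma tlift_linear : linear (tlift b).
Proof.
move=> c u v; rewrite -[u]tclassK -[v]tclassK.
rewrite [c *: _]tclass_scale -[_ + _]tclass_add !tlift_class big_cat /= big_map.
congr (_ + _); rewrite scaler_sumr; apply: eq_bigr => p _ /=.
have b0 : b 0 p.2 = 0.
  by apply: (addrI (b 0 p.2)); have := bl p.2 1 0 0; rewrite !scale1r !addr0.
by have := bl p.2 c p.1 0; rewrite b0 !addr0.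
Qed.

End Lift.

End Tensor.

Definition quadrant (R : realType) : set (R * R) :=
  [set p | 0 <= p.1 /\ 0 <= p.2].

(* A projection-valued measure on the Borel sets of R^2, together with the
   scalar measures S |-> <E(S) x, x>. *)
Record spectralMeasure (R : realType) (H : hilbertType R) := SpectralMeasure {
  spm :> set (R * R) -> H -> H ;
  spm_bounded : forall S, measurable S -> bounded_op (spm S) ;
  spm_selfadjoint : forall S, measurable S -> is_adjoint (spm S) (spm S) ;
  spm_setI : forall S T, measurable S -> measurable T ->
    spm (S `&` T) = spm S \o spm T ;
  spm_setT : spm setT = idfun ;
  spm_measure : H -> {measure set (R * R) -> \bar R} ;
  spm_measureE : forall x S, measurable S ->
    spm_measure x S = (complex.Re '[spm S x, x])%:E
}.

Section FunctionalCalculus.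
Variables (R : realType) (H : hilbertType R).

Definition spectral_integral (E : spectralMeasure H) (f : R * R -> R)
    (T : H -> H) :=
  bounded_op T /\
  forall x,
    (spm_measure E x).-integrable (@quadrant R) (EFin \o f) /\
    '[T x, x] = (\int[spm_measure E x]_(p in @quadrant R) f p)%:C.

(* T = f(A, B): E is the joint spectral measure of (A, B), which is determined
   by its two marginal integrals A and B. *)
Definition joint_calculus (f : R * R -> R) (A B T : H -> H) :=
  exists E : spectralMeasure H,
    [/\ E (@quadrant R) = idfun,
        spectral_integral E fst A,
        spectral_integral E snd B &
        spectral_integral E f T].

End FunctionalCalculus.

Section Forms.
Variables (R : realType) (V : lmodType R[i]).
Implicit Types alpha beta gamma : V -> V -> R[i].

(* Positivity and sesquilinearity of alpha and beta follow from cr_alpha and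
   cr_beta. *)
Record compatible_rep alpha beta (H : hilbertType R) (h : V -> H)
    (A B : H -> H) : Prop := CompatibleRep {
  cr_linear : linear h ;
  cr_dense : dense (range h) ;
  cr_boundedA : bounded_op A ;
  cr_boundedB : bounded_op B ;
  cr_positiveA : positive_op A ;
  cr_positiveB : positive_op B ;
  cr_commute : A \o B = B \o A ;
  cr_alpha : forall x y, alpha x y = '[A (h x), h y] ;
  cr_beta : forall x y, beta x y = '[B (h x), h y]
}.

(* gamma = f(alpha, beta); by Pusz-Woronowicz it does not depend on the
   compatible representation. *)
Definition form_calculus (f : R * R -> R) alpha beta gamma :=
  exists (H : hilbertType R) (h : V -> H) (A B T : H -> H),
    [/\ compatible_rep alpha beta h A B,
        joint_calculus f A B T &
        forall x y, gamma x y = '[T (h x), h y]].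

Definition geometric_fun (p : R * R) : R := Num.sqrt (p.1 * p.2).

(* Division by zero in a field yields 0, so the value at (0, 0) is 0. *)
Definition parallel_fun (p : R * R) : R := p.1 * p.2 / (p.1 + p.2).

Definition form_geometric_mean := form_calculus geometric_fun.
Definition form_parallel_sum := form_calculus parallel_fun.

End Forms.

Section Means.
Variables (R : realType) (H K : hilbertType R).
Variables (M : vnAlgebra H) (N : vnAlgebra K) (L : standardForm N).
Implicit Types Phi Psi Theta : M -> N.

Local Notation MoL := (tensor M (L2 L)).

(* The form s_Phi: cp_form_pure below shows that it does not depend on the
   representatives of the formal sums. *)
Definition cp_form Phi (u v : MoL) : R[i] :=
  \sum_(p <- trepr u) \sum_(q <- trepr v)
    '[L2_rep L (Phi (vn_mul (vn_star q.1) p.1)) p.2, q.2].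

Lemma cp_form_pure Phi (x y : M) (xi eta : L2 L) : linear Phi ->
  cp_form Phi (tpure x xi) (tpure y eta) =
  '[L2_rep L (Phi (vn_mul (vn_star y) x)) xi, eta].
Proof.
move=> Phil.
pose b (y x : M) (xi eta : L2 L) : R[i] :=
  '[L2_rep L (Phi (vn_mul (vn_star y) x)) xi, eta].
have bl y' eta' xi' : linear (fun x' => b y' x' xi' eta' : R[i]^o).
  move=> c u v; rewrite /b.
  have -> : vn_mul (vn_star y') (c *: u + v) =
      c *: vn_mul (vn_star y') u + vn_mul (vn_star y') v.
    apply: val_inj; apply/funext => z.
    by have [/(_ c (u z) (v z)) + _] := vn_bounded (vn_opP (vn_star y')).
  by rewrite Phil L2_rep_linear linearPl.
have bxi y' x' eta' : linear (fun xi' => b y' x' xi' eta' : R[i]^o).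
  move=> c u v; rewrite /b.
  have [-> _] := L2_rep_bounded L (Phi (vn_mul (vn_star y') x')).
  by rewrite linearPl.
have bstar x' xi' eta' : linear (fun y' => (b y' x' xi' eta')^* : R[i]^o).
  move=> c u v; rewrite /b.
  have -> : vn_mul (vn_star (c *: u + v)) x' =
      c^* *: vn_mul (vn_star u) x' + vn_mul (vn_star v) x'.
    apply: val_inj; apply/funext => z; apply: hdot_inj => w.
    transitivity '[(c *: u + v : M) w, x' z]; first by rewrite vn_starP.
    by rewrite [RHS]linearPr /= conjcK -!vn_starP -linearPl.
  by rewrite Phil L2_rep_linear linearPl rmorphD rmorphM /= conjcK.
have beta' y' x' xi' : linear (fun eta' => (b y' x' xi' eta')^* : R[i]^o).
  move=> c u v; rewrite /b linearPr /=.
  by rewrite rmorphD rmorphM /= conjcK.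
have inner x' xi' : \sum_(q <- trepr (tpure y eta)) b q.1 x' xi' q.2 =
    b y x' xi' eta.
  apply: (can_inj (@conjcK R)).
  rewrite rmorph_sum.
  exact: (@tlift_pure _ M (L2 L) R[i]^o (fun y' eta' => (b y' x' xi' eta')^*)).
rewrite /cp_form.
under eq_bigr do rewrite inner.
exact: (@tlift_pure _ M (L2 L) R[i]^o (fun x' xi' => b y x' xi' eta)).
Qed.

Definition represents Theta (gamma : MoL -> MoL -> R[i]) :=
  forall (x y : M) (xi eta : L2 L),
    '[L2_rep L (Theta (vn_mul (vn_star y) x)) xi, eta] =
    gamma (tpure x xi) (tpure y eta).

(* Theta = Phi # Psi and Theta = Phi : Psi; CP maps are determined by the forms
   they represent, so these relations determine Theta. *)
Definition is_geometric_mean Phi Psi Theta :=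
  CP Theta /\
  exists gamma, form_geometric_mean (cp_form Phi) (cp_form Psi) gamma /\
    represents Theta gamma.

Definition is_parallel_sum Phi Psi Theta :=
  CP Theta /\
  exists gamma, form_parallel_sum (cp_form Phi) (cp_form Psi) gamma /\
    represents Theta gamma.

Definition is_harmonic_mean Phi Psi Theta :=
  exists2 Pi, is_parallel_sum Phi Psi Pi & Theta = (fun x => 2 *: Pi x).

Definition cp_arithmetic_mean Phi Psi : M -> N :=
  fun x => 2^-1 *: (Phi x + Psi x).

End Means.

(* Main.v *)
Require Import Defs.
From HB Require Import structures.
From mathcomp Require Import all_boot all_order all_algebra sesquilinear.
From mathcomp Require Import all_classical all_reals all_analysis.
From mathcomp Require Import measurable_realfun.
From mathcomp.real_closed Require Import complex.
From mathcomp Require Import ring lra.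

(** Both inequalities reduce to inequalities between positive forms on the
    tensor product.

    From forms to CP maps: if the forms of two linear maps satisfy
    [gamma u u <= omega u u], then the difference [D] of the maps turns every
    matrix [b^* b] over M into a matrix over N that acts as a positive operator
    on a finite power of L^2(N).  That operator has a self-adjoint square root
    commuting with all that commutes with it, so the entries of the root lie in the
    bicommutant of N, which is N itself; hence [D (b^* b) = c^* c] over N
    ([cp_le_represents], [CP_criterion], [op_matrix_sqrt],
    [positive_op_sqrt]).  The root is obtained by the classical iteration
    [Y := (X + Y^2) / 2], dominated by the same iteration on scalars.

    Geometric against arithmetic: one compatible representation carries both,
    and [2 sqrt(rs) <= r + s] holds pointwise under the spectral integral.

    Harmonic against geometric: the two means may be given on two unrelated
    compatible representations, so they are compared through a quantity that
    depends on the forms only, namely the infimum over v of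
    [alpha(v,v) + beta(u-v,u-v)].  In the representation of the parallel sum,
    every such value bounds the parallel sum from above ([parallel_le]).  In the
    representation of the geometric mean, the infimum is at most half the
    geometric mean ([geometric_split]): ideally v is the image of u under the
    spectral function s/(r+s), for which the value is rs/(r+s), at most
    sqrt(rs)/2.  Both facts are proved by cutting the quadrant into n thin
    sectors on which s/(r+s) is constant up to 1/n: on the range of the
    spectral projection of a sector the operators are nearly proportional to
    A + B, different sectors are orthogonal for every form at hand, and the
    total error is O(1/n).  Density of the range of h then brings v back into
    the tensor product. *)

Set Implicit Arguments.
Unset Strict Implicit.
Unset Printing Implicit Defensive.

Import Order.TTheory GRing.Theory Num.Theory numFieldNormedType.Exports.
Local Open Scope classical_set_scope.
Local Open Scope ring_scope.
Local Open Scope complex_scope.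

(** * Sesquilinear forms *)

Lemma conj_imaginary (R : realType) : conjc 'i%C = - 'i%C :> R[i].
Proof. by apply/eqP; rewrite eq_complex /= oppr0 !eqxx. Qed.

Section SesquilinearForms.
Variables (R : realType) (V : lmodType R[i]).

Record sesquilinear_form (s : V -> V -> R[i]) : Prop := SesquilinearForm {
  sesquiPl : forall c x y z, s (c *: x + y) z = c * s x z + s y z ;
  sesquiPr : forall c x y z, s z (c *: x + y) = conjc c * s z x + s z y }.

Variables (s : V -> V -> R[i]) (ss : sesquilinear_form s).

Lemma sesquiDl x y z : s (x + y) z = s x z + s y z.
Proof. by rewrite -[x in LHS]scale1r (sesquiPl ss) mul1r. Qed.

Lemma sesquiDr x y z : s z (x + y) = s z x + s z y.
Proof. by rewrite -[x in LHS]scale1r (sesquiPr ss) rmorph1 mul1r. Qed.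

Lemma sesqui0l z : s 0 z = 0.
Proof. by apply: (addrI (s 0 z)); rewrite -sesquiDl !addr0. Qed.

Lemma sesqui0r z : s z 0 = 0.
Proof. by apply: (addrI (s z 0)); rewrite -sesquiDr !addr0. Qed.

Lemma sesquiZl c x z : s (c *: x) z = c * s x z.
Proof. by rewrite -[_ *: _]addr0 (sesquiPl ss) sesqui0l addr0. Qed.

Lemma sesquiZr c x z : s z (c *: x) = conjc c * s z x.
Proof. by rewrite -[_ *: _]addr0 (sesquiPr ss) sesqui0r addr0. Qed.

Lemma sesquiNl x z : s (- x) z = - s x z.
Proof. by rewrite -scaleN1r sesquiZl mulN1r. Qed.

Lemma sesquiNr x z : s z (- x) = - s z x.
Proof. by rewrite -scaleN1r sesquiZr rmorphN rmorph1 mulN1r. Qed.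

Lemma sesqui_suml (I : Type) (r : seq I) (P : pred I) (f : I -> V) z :
  s (\sum_(i <- r | P i) f i) z = \sum_(i <- r | P i) s (f i) z.
Proof. by apply: (big_morph (s^~ z)) => [x y|]; rewrite (sesquiDl, sesqui0l). Qed.

Lemma sesqui_sumr (I : Type) (r : seq I) (P : pred I) (f : I -> V) z :
  s z (\sum_(i <- r | P i) f i) = \sum_(i <- r | P i) s z (f i).
Proof. by apply: (big_morph (s z)) => [x y|]; rewrite (sesquiDr, sesqui0r). Qed.

Lemma sesqui_diagD x y : s (x + y) (x + y) = s x x + s y y + (s x y + s y x).
Proof. by rewrite !sesquiDl !sesquiDr; ring. Qed.

(** Polarisation: reality of the diagonal at [x + y] controls the imaginary
    parts, and at [x + i y] the real parts. *)
Lemma sesqui_herm : (forall x, s x x \is Num.real) -> forall x y, s y x = conjc (s x y).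
Proof.
move=> sr x y.
have r1 : s x y + s y x \is Num.real.
  have -> : s x y + s y x = s (x + y) (x + y) - s x x - s y y.
    by rewrite sesqui_diagD; ring.
  by rewrite !rpredB.
have r2 : 'i%C * (s y x - s x y) \is Num.real.
  have -> : 'i%C * (s y x - s x y) = s (x + 'i%C *: y) (x + 'i%C *: y) - s x x - s y y.
    rewrite sesqui_diagD !sesquiZr !sesquiZl.
    rewrite conj_imaginary.
    have e : 'i%C * 'i%C = -1 :> R[i] by rewrite -expr2 sqr_i.
    have -> : - 'i%C * ('i%C * s y y) = s y y by rewrite mulrA mulNr e opprK mul1r.
    by ring.
  by rewrite !rpredB.
move: r1 r2; case: (s x y) => a b; case: (s y x) => c d /=.
move=> /RIm_real [] /= e1 /RIm_real[] /= e2.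
apply/eqP; rewrite eq_complex /=; apply/andP; split; apply/eqP; lra.
Qed.

(** Additivity of the quadratic form is tested at [c = 1], giving
    [s x y + s y x = 0], and at [c = i], giving [s x y = s y x]. *)
Lemma sesqui_ortho x y :
  (forall c, s (x + c *: y) (x + c *: y) = s x x + s (c *: y) (c *: y)) -> s x y = 0.
Proof.
move=> h; have h1 := h 1; have h2 := h 'i%C.
rewrite !scale1r in h1; rewrite !sesqui_diagD in h1 h2.
have {h1}e1 : s x y + s y x = 0 by apply: (addrI (s x x + s y y)); rewrite h1 addr0.
have {h2} : s x ('i%C *: y) + s ('i%C *: y) x = 0.
  by apply: (addrI (s x x + s ('i%C *: y) ('i%C *: y))); rewrite h2 addr0.
rewrite sesquiZr sesquiZl.
move: e1; case: (s x y) => a b; case: (s y x) => c d /=.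
move=> /eqP; rewrite eq_complex /= => /andP[/eqP e1 /eqP e2].
move=> /eqP; rewrite eq_complex /= => /andP[/eqP e3 /eqP e4].
apply/eqP; rewrite eq_complex /=; apply/andP; split; apply/eqP; lra.
Qed.

Hypothesis s0 : forall x, 0 <= s x x.

Lemma psd_herm x y : s y x = conjc (s x y).
Proof. by apply: sesqui_herm => z; exact: ger0_real. Qed.

(** The form may be degenerate: when [s y y = 0] the quadratic polynomial in
    [t] degenerates to an affine one, which is nonnegative everywhere only if
    [s x y = 0]. *)
Lemma psd_CauchySchwarz x y : `|s x y| ^+ 2 <= s x x * s y y.
Proof.
set a := s x y; set P := s x x; set Q := s y y.
have Qr : conjc Q = Q by apply: conj_Creal; apply: ger0_real; exact: s0.
have aa : `|a| ^+ 2 = a * conjc a by rewrite normCK.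
have key t : t \is Num.real -> 0 <= P - 2 * t * `|a| ^+ 2 + t ^+ 2 * Q * `|a| ^+ 2.
  move=> tr; have tc : conjc t = t by exact: conj_Creal.
  have := s0 (x - (t * a) *: y).
  rewrite sesqui_diagD !(sesquiNl, sesquiNr, sesquiZl, sesquiZr) -/P -/Q.
  rewrite (psd_herm x y) -/a rmorphM /= tc => h.
  apply: le_trans h _; rewrite le_eqVlt; apply/orP; left; apply/eqP.
  by rewrite aa; ring.
have [Q0|Q0] := eqVneq Q 0.
  have [->|a0] := eqVneq a 0; first by rewrite normr0 expr0n Q0 mulr0.
  have na : `|a| ^+ 2 != 0 by rewrite expf_neq0 // normr_eq0.
  have Pr : P \is Num.real by apply: ger0_real; exact: s0.
  (* at this t the affine function takes the value -1 *)
  have := key ((P + 1) / (2 * `|a| ^+ 2)).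
  have -> : P - 2 * ((P + 1) / (2 * `|a| ^+ 2)) * `|a| ^+ 2 +
     ((P + 1) / (2 * `|a| ^+ 2)) ^+ 2 * Q * `|a| ^+ 2 = -1.
    rewrite Q0; move: na; move: (`|a| ^+ 2) => n na; by field.
  rewrite ler0N1 => h; exfalso; apply: notF; apply: h.
  by rewrite rpredM ?rpredV ?rpredM ?rpredD ?rpredX ?normr_real ?real1 ?realn.
have Q1 : 0 < Q by rewrite lt_def Q0 s0.
have := key Q^-1; rewrite rpredV (ger0_real (s0 y)) => /(_ isT).
have -> : P - 2 * Q^-1 * `|a| ^+ 2 + Q^-1 ^+ 2 * Q * `|a| ^+ 2 = P - `|a|^+2 / Q.
  by field.
by rewrite subr_ge0 ler_pdivrMr.
Qed.

End SesquilinearForms.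

(** * Linear maps on Hilbert spaces, and finite direct sums *)

Section LinearFunctions.
Variables (C : pzRingType) (U V : lmodType C) (T : U -> V) (Tl : linear T).

Lemma op_0 : T 0 = 0.
Proof. by have := Tl (-1) 0 0; rewrite scaler0 addr0 scaleN1r addNr. Qed.

Lemma op_D x y : T (x + y) = T x + T y.
Proof. by have := Tl 1 x y; rewrite !scale1r. Qed.

Lemma op_Z c x : T (c *: x) = c *: T x.
Proof. by have := Tl c x 0; rewrite !addr0 op_0 addr0. Qed.

Lemma op_sub x y : T (x - y) = T x - T y.
Proof. by rewrite addrC -scaleN1r Tl scaleN1r addrC. Qed.

Lemma op_sum (I : Type) (r : seq I) (P : pred I) (f : I -> U) :
  T (\sum_(i <- r | P i) f i) = \sum_(i <- r | P i) T (f i).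
Proof. by apply: (big_morph T) => [x y|]; rewrite (op_D, op_0). Qed.

End LinearFunctions.

Lemma linear_continuousP (R : realType) (V W : normedModType R[i]) (T : V -> W) :
  linear T ->
  continuous T <-> exists2 M : R[i], 0 < M & forall x, `|T x| <= M * `|x|.
Proof.
move=> Tl; pose f := HB.pack_for {linear V -> W} T (GRing.isLinear.Build _ _ _ _ T Tl).
split.
  move=> /(linear_bounded_continuous f) /linear_boundedP [M [Mr h]].
  exists (`|M| + 1) => [|x]; first by rewrite ltr_wpDl.
  apply: (h (`|M| + 1)); rewrite (le_lt_trans (real_ler_norm Mr)) // ltrDl //.
move=> [M M0 h]; apply/(linear_bounded_continuous f)/linear_boundedP.
exists M; split; first exact: gtr0_real.
move=> N MN x; apply: le_trans (h x) _; apply: ler_wpM2r => //; exact: ltW.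
Qed.

Section HilbertOperators.
Variables (R : realType) (H : hilbertType R).
Implicit Types (x y z : H) (T S : H -> H).

Lemma hdot_sesqui : sesquilinear_form (fun x y : H => '[x, y]).
Proof. by split=> c x y z; rewrite (linearPl, linearPr). Qed.

Lemma hdot_ge0 x : 0 <= '[x, x].
Proof. by rewrite -hnormE exprn_ge0. Qed.

Lemma hdot_conj x y : '[y, x] = conjc '[x, y].
Proof. exact: psd_herm hdot_sesqui hdot_ge0 x y. Qed.

Lemma hdot_normM x y : `|'[x, y]| <= `|x| * `|y|.
Proof.
rewrite -ler_sqr ?nnegrE ?mulr_ge0 // exprMn !hnormE.
exact: psd_CauchySchwarz hdot_sesqui hdot_ge0 x y.
Qed.

Lemma hdot_cvg (I : Type) (F : set_system I) {FF : Filter F} (u v : I -> H) x y :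
  u @ F --> x -> v @ F --> y -> '[u i, v i] @[i --> F] --> '[x, y].
Proof.
move=> ux vy; apply/cvgrPdist_lt => e e0.
have y0 : 0 < `|y| + 1 by rewrite ltr_wpDl.
have x0 : 0 < `|x| + 1 by rewrite ltr_wpDl.
near=> i.
have -> : '[x, y] - '[u i, v i] = '[x - u i, y] + '[u i, y - v i].
  by rewrite linearBl linearBr addrA subrK.
rewrite (splitr e); apply: le_lt_trans (ler_normD _ _) _; apply: ltrD.
  apply: le_lt_trans (hdot_normM _ _) _.
  apply: (@le_lt_trans _ _ (`|x - u i| * (`|y| + 1))).
    by apply: ler_wpM2l => //; rewrite lerDl.
  rewrite -ltr_pdivlMr //; near: i.
  by apply: cvgr_dist_lt => //; rewrite !divr_gt0.
apply: le_lt_trans (hdot_normM _ _) _.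
apply: (@le_lt_trans _ _ ((`|x| + 1) * `|y - v i|)).
  apply: ler_wpM2r => //; apply/ltW; near: i.
  by apply: (cvgr_norm_lt _ ux); rewrite ltrDl.
rewrite mulrC -ltr_pdivlMr //; near: i.
by apply: cvgr_dist_lt => //; rewrite !divr_gt0.
Unshelve. all: by end_near. Qed.

Lemma op_sesqui T : linear T -> sesquilinear_form (fun x y => '[T x, y]).
Proof. by move=> Tl; split=> c x y z; rewrite ?Tl (linearPl, linearPr). Qed.

Lemma positive_selfadjoint T : linear T -> positive_op T -> is_adjoint T T.
Proof.
by move=> Tl Tp x y; rewrite [RHS]hdot_conj; exact: psd_herm (op_sesqui Tl) Tp y x.
Qed.

End HilbertOperators.

Section HilbertSum.
Variables (R : realType) (E : hilbertType R) (n : nat).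

(** The l^2 direct sum of n copies of E.  A separate name keeps it apart from
    the function type, which carries no inner product norm. *)
Definition hsum : Type := 'I_n -> E.

HB.instance Definition _ := GRing.Lmodule.copy hsum ('I_n -> E).

Implicit Types v w : hsum.

Definition hsum_dot v w : R[i] := \sum_i '[v i, w i].

Lemma hsum_dot_sesqui : sesquilinear_form hsum_dot.
Proof.
split=> c v w u; rewrite mulr_sumr -big_split; apply: eq_bigr => i _ /=.
  exact: (sesquiPl (@hdot_sesqui R E)).
exact: (sesquiPr (@hdot_sesqui R E)).
Qed.

Lemma hsum_dot_ge0 v : 0 <= hsum_dot v v.
Proof. by apply: sumr_ge0 => i _; exact: hdot_ge0. Qed.

Definition hsum_norm v : R[i] := sqrtC (hsum_dot v v).

Lemma hsum_norm_ge0 v : 0 <= hsum_norm v.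
Proof. by rewrite sqrtC_ge0 hsum_dot_ge0. Qed.

Lemma hsum_normK v : hsum_norm v ^+ 2 = hsum_dot v v.
Proof. exact: sqrtCK. Qed.

Lemma hsum_norm_ge v i : `|v i| <= hsum_norm v.
Proof.
rewrite -ler_sqr ?nnegrE ?hsum_norm_ge0 // hsum_normK hnormE.
rewrite /hsum_dot (bigD1 i) //= lerDl; apply: sumr_ge0 => j _; exact: hdot_ge0.
Qed.

Lemma hsum_norm_le v : hsum_norm v <= \sum_i `|v i|.
Proof.
rewrite -ler_sqr ?nnegrE ?hsum_norm_ge0 ?sumr_ge0 // hsum_normK.
rewrite expr2 mulr_suml; apply: ler_sum => i _.
rewrite -hnormE expr2; apply: ler_wpM2l => //.
by rewrite (bigD1 i) //= lerDl sumr_ge0.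
Qed.

Lemma hsum_normD v w : hsum_norm (v + w) <= hsum_norm v + hsum_norm w.
Proof.
rewrite -ler_sqr ?nnegrE ?addr_ge0 ?hsum_norm_ge0 // hsum_normK.
rewrite (sesqui_diagD hsum_dot_sesqui) sqrrD !hsum_normK.
rewrite addrAC lerD2r lerD2l (psd_herm hsum_dot_sesqui hsum_dot_ge0 v w).
set a := hsum_dot v w.
have ar : a + conjc a \is Num.real by rewrite addcJ rpredM ?realn // ; apply/complex_realP; exists (complex.Re a).
apply: le_trans (real_ler_norm ar) _.
apply: le_trans (ler_normD _ _) _.
have -> : `|conjc a| = `|a| by exact: norm_conjC.
rewrite -mulr2n ler_pMn2r // -ler_sqr ?nnegrE ?mulr_ge0 ?hsum_norm_ge0 //.
rewrite exprMn !hsum_normK.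
exact: psd_CauchySchwarz hsum_dot_sesqui hsum_dot_ge0 v w.
Qed.

Lemma hsum_normZ (c : R[i]) v : hsum_norm (c *: v) = `|c| * hsum_norm v.
Proof.
apply/eqP; rewrite -(@eqrXn2 _ 2) ?mulr_ge0 ?hsum_norm_ge0 //.
rewrite exprMn !hsum_normK (sesquiZl hsum_dot_sesqui) (sesquiZr hsum_dot_sesqui).
by rewrite mulrA normCK.
Qed.

Lemma hsum_norm_eq0 v : hsum_norm v = 0 -> v = 0.
Proof.
move=> v0; apply/funext => i; apply/normr0_eq0/eqP.
by rewrite -normr_le0 normr_id -v0 hsum_norm_ge.
Qed.

HB.instance Definition _ := Lmodule_isNormed.Build R[i] hsum
  hsum_normD hsum_normZ hsum_norm_eq0.

Lemma hsum_cauchy_cvg (F : set_system hsum) : ProperFilter F -> cauchy F -> cvg F.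
Proof.
move=> FF /cauchyP Fc.
have Fi i : cvg ((fun v : hsum => v i) @ F).
  apply: cauchy_cvg; apply/cauchyP => e e0.
  have [v Fv] := Fc e e0; exists (v i).
  change (F (fun w => ball (v i) e (w i))); apply: filterS Fv => w.
  rewrite -!ball_normE /=; apply: le_lt_trans; exact: (hsum_norm_ge (v - w)).
pose l : hsum := fun i => lim ((fun v : hsum => v i) @ F).
apply/cvg_ex; exists l; apply/cvgrPdist_lt => e e0.
have en : 0 < e / n.+1%:R by rewrite divr_gt0.
near=> w.
apply: le_lt_trans (hsum_norm_le (l - w)) _.
apply: (@le_lt_trans _ _ (\sum_(i < n) e / n.+1%:R)).
  apply: ler_sum => i _; apply/ltW; move: i.
  near: w; apply: filter_forall => i.
  by move: (Fi i) => /cvgrPdist_lt; apply.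
rewrite sumr_const card_ord -[ltRHS](divfK (_ : n.+1%:R != 0)) ?pnatr_eq0 //.
by rewrite -[ltLHS]mulr_natr ltr_pM2l // ltr_nat.
Unshelve. all: by end_near. Qed.

HB.instance Definition _ := Uniform_isComplete.Build hsum hsum_cauchy_cvg.

Lemma hsum_dot_bilinear : bilinear_for *%R (@conjc R \; *%R) hsum_dot.
Proof.
split=> [w c v u|v c w u].
  exact: (sesquiPl hsum_dot_sesqui).
exact: (sesquiPr hsum_dot_sesqui).
Qed.

HB.instance Definition _ :=
  @bilinear_isBilinear.Build R[i] hsum hsum R[i] _ _ hsum_dot hsum_dot_bilinear.

Lemma hsum_dot_herm v w : hsum_dot v w = (-1) ^+ false * conjc (hsum_dot w v).
Proof. by rewrite mul1r; exact: psd_herm hsum_dot_sesqui hsum_dot_ge0 w v. Qed.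

HB.instance Definition _ :=
  @isHermitianSesquilinear.Build R[i] hsum false (@conjc R) hsum_dot hsum_dot_herm.

Lemma hsum_dot_gt0 v : v != 0 -> 0 < hsum_dot v v.
Proof.
move=> v0; rewrite -hsum_normK exprn_gt0 // lt_def hsum_norm_ge0 andbT.
by apply: contra_neq v0; exact: hsum_norm_eq0.
Qed.

HB.instance Definition _ := @isDotProduct.Build R[i] hsum hsum_dot hsum_dot_gt0.

HB.instance Definition _ := @isHilbert.Build R hsum hsum_dot hsum_normK.

End HilbertSum.

(** * Square roots of positive operators *)

Section SquareRoot.
Variables (R : realType) (H : hilbertType R).
Implicit Types (x y z v w : H).

(** The iteration of the square root applied to the scalar 1.  Since the
    iterates are polynomials in [X] with nonnegative coefficients, these numbers
    bound the norms of the iterates, and their increments bound the norms of the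
    increments, whenever [X] is a contraction. *)
Fixpoint majorant (n : nat) : R := if n is m.+1 then (1 + majorant m ^+ 2) / 2 else 0.

Lemma majorant_bounds n : 0 <= majorant n <= 1.
Proof.
elim: n => [|n /andP[h0 h1]] /=; first by rewrite lexx ler01.
have : majorant n ^+ 2 <= 1 by rewrite expr_le1.
have := sqr_ge0 (majorant n); move: (majorant n ^+ 2) => a a0 a1.
apply/andP; split; lra.
Qed.

Lemma majorantS n : majorant n <= majorant n.+1.
Proof.
rewrite -subr_ge0 /=.
have -> : (1 + majorant n ^+ 2) / 2 - majorant n = (1 - majorant n) ^+ 2 / 2 by field.
by rewrite divr_ge0 ?sqr_ge0.
Qed.

Lemma majorant_nd : nondecreasing_seq majorant.
Proof. by apply/nondecreasing_seqP; exact: majorantS. Qed.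

Lemma majorant_cvg : cvgn majorant.
Proof.
apply: nondecreasing_is_cvgn; first exact: majorant_nd.
by exists 1 => _ [n _ <-]; case/andP: (majorant_bounds n).
Qed.

Variables (X : H -> H) (Xl : linear X) (Xc : forall v, `|X v| <= `|v|).

Fixpoint sqrt_iter (n : nat) : H -> H :=
  if n is m.+1 then fun v => 2^-1 *: (X v + sqrt_iter m (sqrt_iter m v))
  else fun=> 0.

Lemma sqrt_iter_linear n : linear (sqrt_iter n).
Proof.
elim: n => [|n IH] c u v /=; first by rewrite scaler0 addr0.
by rewrite Xl !IH !scalerDr !scalerA [c * _]mulrC addrACA.
Qed.

Lemma sqrt_iter_comm C : linear C -> C \o X = X \o C ->
  forall n v, C (sqrt_iter n v) = sqrt_iter n (C v).
Proof.
move=> Cl CX; elim=> [|n IH] v /=; first exact: op_0.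
rewrite (op_Z Cl) (op_D Cl).
by rewrite !IH; have /= -> := congr1 (fun f => f v) CX.
Qed.

Lemma sqrt_iter_le n v : `|sqrt_iter n v| <= (majorant n)%:C * `|v|.
Proof.
elim: n v => [|n IH] v /=; first by rewrite normr0 mul0r.
rewrite normrZ.
have -> : `|2^-1 : R[i]| = 2^-1 by rewrite ger0_norm.
have -> : ((1 + majorant n ^+ 2) / 2)%:C * `|v| =
   2^-1 * (`|v| + (majorant n)%:C * ((majorant n)%:C * `|v|)) :> R[i].
  by rewrite rmorphM fmorphV rmorphD rmorphXn rmorph1 rmorph_nat /=; field.
apply: ler_wpM2l; first by rewrite invr_ge0.
apply: le_trans (ler_normD _ _) _; apply: lerD => //.
apply: le_trans (IH _) _; apply: ler_wpM2l => //.
by rewrite ler0c; case/andP: (majorant_bounds n).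
Qed.

Lemma sqrt_iter_contract n v : `|sqrt_iter n v| <= `|v|.
Proof.
apply: le_trans (sqrt_iter_le n v) _; rewrite ler_piMl // -[1]/((1 : R)%:C) lecR.
by case/andP: (majorant_bounds n).
Qed.

(** [Y^2 - Z^2 = Y (Y - Z) + (Y - Z) Z] turns the bounds on the iterates
    and on the previous increment into the next scalar increment. *)
Lemma sqrt_iter_diff n v :
  `|sqrt_iter n.+1 v - sqrt_iter n v| <= (majorant n.+1 - majorant n)%:C * `|v|.
Proof.
elim: n v => [|n IH] v.
  by have := sqrt_iter_le 1 v; rewrite /= !subr0.
set Y := sqrt_iter n.+1; set Z := sqrt_iter n.
have -> : sqrt_iter n.+2 v - Y v = 2^-1 *: (Y (Y v - Z v) + (Y (Z v) - Z (Z v))).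
  rewrite -[LHS]/(2^-1 *: (X v + Y (Y v)) - 2^-1 *: (X v + Z (Z v))).
  rewrite -scalerBr opprD addrACA subrr add0r.
  by rewrite (op_sub (sqrt_iter_linear n.+1 : linear Y)) addrA subrK.
rewrite normrZ.
have -> : `|2^-1 : R[i]| = 2^-1 by rewrite ger0_norm.
have y0 k : 0 <= (majorant k)%:C by rewrite ler0c; case/andP: (majorant_bounds k).
set a := majorant n.+1; set b := majorant n.
have -> : (majorant n.+2 - a)%:C * `|v| =
  2^-1 * (a%:C * ((a - b)%:C * `|v|) + (a - b)%:C * (b%:C * `|v|)) :> R[i].
  have -> : majorant n.+2 - a = 2^-1 * (a * (a - b) + (a - b) * b).
    by rewrite /a /b /=; field.
  by rewrite !(rmorphM, fmorphV, rmorphD, rmorph_nat, rmorphB) /=; field.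
apply: ler_wpM2l; first by rewrite invr_ge0.
have d0 : 0 <= (a - b)%:C by rewrite ler0c subr_ge0 majorantS.
apply: le_trans (ler_normD _ _) _; apply: lerD.
  by apply: le_trans (sqrt_iter_le _ _) _; apply: ler_wpM2l => //; exact: IH.
by apply: le_trans (IH _) _; apply: ler_wpM2l => //; exact: sqrt_iter_le.
Qed.

Lemma sqrt_iter_cauchy n m v : (n <= m)%N ->
  `|sqrt_iter n v - sqrt_iter m v| <= (majorant m - majorant n)%:C * `|v|.
Proof.
move=> /subnK <-; elim: (m - n)%N => [|k IH].
  by rewrite add0n !subrr normr0 mul0r.
rewrite addSn; set j := (k + n)%N in IH *.
have -> : sqrt_iter n v - sqrt_iter j.+1 v =
  (sqrt_iter n v - sqrt_iter j v) - (sqrt_iter j.+1 v - sqrt_iter j v).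
  by rewrite opprB addrA subrK.
apply: le_trans (ler_normB _ _) _.
apply: le_trans (lerD IH (sqrt_iter_diff _ _)) _.
by rewrite -mulrDl -rmorphD addrC addrA subrK.
Qed.

Lemma sqrt_iter_cvg v : cvg (sqrt_iter n v @[n --> \oo]).
Proof.
apply: cauchy_cvg; apply/cauchyP => e e0.
pose l := limn majorant.
have v0 : 0 < `|v| + 1 by rewrite ltr_wpDl.
pose d := complex.Re (e / (`|v| + 1)).
have dE : d%:C = e / (`|v| + 1) by apply: RRe_real; apply: gtr0_real; rewrite divr_gt0.
have d0 : 0 < d by rewrite -ltcR dE divr_gt0.
have [n _ nl] : \forall n \near \oo, `|l - majorant n| < d.
  exact: cvgr_dist_lt majorant_cvg _ d0.
exists (sqrt_iter n v).
exists n => // m /= nm.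
rewrite -ball_normE /=; apply: le_lt_trans (sqrt_iter_cauchy _ nm) _.
apply: (@le_lt_trans _ _ ((majorant m - majorant n)%:C * (`|v| + 1))).
  apply: ler_wpM2l; last by rewrite lerDl.
  by rewrite ler0c subr_ge0 majorant_nd.
rewrite -ltr_pdivlMr // -dE ltcR; apply: le_lt_trans (nl n (leqnn n)).
apply: le_trans _ (ler_norm _); rewrite lerD2r.
by apply: nondecreasing_cvgn_le; [exact: majorant_nd|exact: majorant_cvg].
Qed.

Definition sqrt_limit v : H := lim (sqrt_iter n v @[n --> \oo]).

Lemma sqrt_limit_cvg v : sqrt_iter n v @[n --> \oo] --> sqrt_limit v.
Proof. exact: sqrt_iter_cvg. Qed.

Lemma sqrt_limit_linear : linear sqrt_limit.
Proof.
move=> c u v; apply: (@cvg_unique _ _ (sqrt_iter n (c *: u + v) @[n --> \oo])) => //.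
  exact: sqrt_limit_cvg.
rewrite (_ : (fun n => sqrt_iter n _) = fun n => c *: sqrt_iter n u + sqrt_iter n v).
by apply: cvgD; [apply: cvgZr|]; exact: sqrt_limit_cvg.
by apply/funext => n; exact: sqrt_iter_linear.
Qed.

Lemma sqrt_limit_contract v : `|sqrt_limit v| <= `|v|.
Proof.
apply/ler_addgt0Pr => e e0; near \oo => n.
rewrite -[sqrt_limit v](subrK (sqrt_iter n v)) addrC.
apply: le_trans (ler_normD _ _) _; apply: lerD; first exact: sqrt_iter_contract.
apply/ltW; near: n.
by apply: cvgr_dist_lt => //; exact: sqrt_limit_cvg.
Unshelve. all: by end_near. Qed.

Lemma sqrt_limit_comm C : bounded_op C -> C \o X = X \o C ->
  C \o sqrt_limit = sqrt_limit \o C.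
Proof.
move=> [Cl Cc] CX; apply/funext => v /=.
apply: (@cvg_unique _ _ (C (sqrt_iter n v) @[n --> \oo])) => //.
  by apply: continuous_cvg; [exact: Cc|exact: sqrt_limit_cvg].
rewrite (_ : (fun n => C _) = fun n => sqrt_iter n (C v)); last first.
  by apply/funext => n; exact: sqrt_iter_comm.
exact: sqrt_limit_cvg.
Qed.

(** The limit Y satisfies [2 Y = X + Y^2], that is [(1 - Y)^2 = 1 - X]. *)
Lemma sqrt_limit_fixpoint v :
  sqrt_limit v = 2^-1 *: (X v + sqrt_limit (sqrt_limit v)).
Proof.
apply: (@cvg_unique _ _ (sqrt_iter n.+1 v @[n --> \oo])) => //.
  by have := @sqrt_limit_cvg v; rewrite -(cvg_shiftS (fun n => sqrt_iter n v)).
apply: cvgZr; apply: cvgD; first exact: cvg_cst.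
apply/cvgrPdist_lt => e e0; near=> n.
rewrite -(subrKA (sqrt_iter n (sqrt_limit v))).
rewrite -(op_sub (sqrt_iter_linear n)) (splitr e).
apply: le_lt_trans (ler_normD _ _) _; apply: ltrD.
  near: n; apply: cvgr_dist_lt; [exact: sqrt_limit_cvg|by rewrite divr_gt0].
apply: le_lt_trans (sqrt_iter_contract _ _) _.
near: n; apply: cvgr_dist_lt; [exact: sqrt_limit_cvg|by rewrite divr_gt0].
Unshelve. all: by end_near. Qed.

Lemma sqrt_limit_selfadjoint : is_adjoint X X -> is_adjoint sqrt_limit sqrt_limit.
Proof.
move=> Xa u v.
have Ya n u' v' : '[sqrt_iter n u', v'] = '[u', sqrt_iter n v'].
  elim: n u' v' => [|n IH] u' v' /=; first by rewrite linear0l linear0r.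
  rewrite (sesquiZl (hdot_sesqui H)) (sesquiZr (hdot_sesqui H)).
  rewrite (sesquiDl (hdot_sesqui H)) (sesquiDr (hdot_sesqui H)) Xa !IH.
  by have -> : conjc (2^-1 : R[i]) = 2^-1 by rewrite fmorphV rmorph_nat.
apply: (@cvg_unique _ _ ('[sqrt_iter n u, v] @[n --> \oo])) => //.
  by apply: hdot_cvg; [exact: sqrt_limit_cvg|exact: cvg_cst].
rewrite (_ : (fun n => '[_, _]) = fun n => '[u, sqrt_iter n v]); last first.
  by apply/funext => n; exact: Ya.
by apply: hdot_cvg; [exact: cvg_cst|exact: sqrt_limit_cvg].
Qed.

End SquareRoot.

Section PositiveSquareRoot.
Variables (R : realType) (H : hilbertType R).

(** With M a bound for P, the operator [X = 1 - P / M] is a contraction, and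
    the root is [sqrt M (1 - Y)], where Y is the limit of the iteration.  The
    contraction property amounts to [P^2 <= M P], which comes from positivity
    of P at [v - P v / M]. *)
Theorem positive_op_sqrt (P : H -> H) : bounded_op P -> positive_op P ->
  exists S : H -> H, [/\ bounded_op S, is_adjoint S S, S \o S = P &
    forall C, bounded_op C -> C \o P = P \o C -> C \o S = S \o C].
Proof.
move=> [Pl Pc] P0; have Pa := positive_selfadjoint Pl P0.
have Ps := op_sesqui Pl.
have hs := hdot_sesqui H.
have [M M0 PM] := (linear_continuousP Pl).1 Pc.
have Mr : conjc M^-1 = M^-1.
  by apply: conj_Creal; rewrite rpredV; exact: gtr0_real.
have Mne : M != 0 by rewrite gt_eqF.
pose X v := v - M^-1 *: P v.
have Xl : linear X.
  move=> c u v; rewrite /X Pl scalerBr !scalerDr !scalerA [c * _]mulrC opprD.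
  by rewrite addrACA.
have PP v : '[P v, P v] <= M * '[P v, v].
  have PPv : '[P (P v), P v] <= M * '[P v, P v].
    rewrite -hnormE expr2 mulrA.
    apply: le_trans (real_ler_norm (ger0_real (P0 _))) _.
    by apply: le_trans (hdot_normM _ _) _; exact: ler_wpM2r.
  have := P0 (v - M^-1 *: P v).
  rewrite (sesqui_diagD Ps) !(sesquiNl Ps, sesquiNr Ps).
  rewrite !(sesquiZl Ps, sesquiZr Ps) [in '[P (P v), v]]Pa.
  rewrite Mr; move: PPv.
  set a := '[P v, v]; set b := '[P v, P v]; set c := '[P (P v), P v].
  set k := M^-1 => cb h.
  have k0 : 0 < k by rewrite invr_gt0.
  have kM : k * M = 1 by rewrite mulVf.
  have h1 : 0 <= (a - k * b) + (k * (k * c - b)).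
    by apply: le_trans h _; rewrite le_eqVlt; apply/orP; left; apply/eqP; ring.
  have h2 : k * (k * c - b) <= 0.
    rewrite pmulr_rle0 // subr_le0.
    have -> : b = k * (M * b) by rewrite mulrA kM mul1r.
    by rewrite ler_pM2l.
  have : 0 <= a - k * b.
    by apply: le_trans h1 _; rewrite gerDl.
  by rewrite subr_ge0 -(ler_pM2l M0) mulrA [M * k]mulrC kM mul1r.
have Xc v : `|X v| <= `|v|.
  rewrite -ler_sqr ?nnegrE // !hnormE /X.
  rewrite (sesqui_diagD hs) !(sesquiNl hs, sesquiNr hs, sesquiZl hs, sesquiZr hs) Mr.
  rewrite -[ '[v, P v]]Pa.
  have k0 : 0 < M^-1 by rewrite invr_gt0.
  set a := '[P v, v]; set b := '[P v, P v].
  rewrite [leLHS](_ : _ = '[v, v] + M^-1 * (M^-1 * b - a) - M^-1 * a); last by ring.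
  rewrite -addrA gerDl -mulrBr pmulr_rle0 //.
  have : M^-1 * b <= a.
    by have := PP v; rewrite -(ler_pM2l k0) mulrA mulVf // mul1r.
  move=> h; rewrite subr_le0; apply: le_trans (_ : 0 <= _); first by rewrite subr_le0.
  exact: P0.
have Xa : is_adjoint X X.
  move=> u v; rewrite /X.
  by rewrite !(sesquiDl hs, sesquiDr hs, sesquiNl hs, sesquiNr hs, sesquiZl hs, sesquiZr hs) Mr Pa.
pose Y := sqrt_limit X.
have Yl : linear Y := sqrt_limit_linear Xl Xc.
pose r := sqrtC M.
have r0 : 0 <= r by rewrite sqrtC_ge0 ltW.
have rr : conjc r = r by apply: conj_Creal; exact: ger0_real.
have rM : r * r = M by rewrite -expr2 sqrtCK.
pose S v := r *: (v - Y v).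
have Sl : linear S.
  move=> c u v; rewrite /S Yl opprD addrACA -scalerBr scalerDr !scalerA.
  by rewrite [c * _]mulrC.
have Sc : continuous S.
  apply/(linear_continuousP Sl); exists (r * 2 + 1) => [|v].
    by rewrite ltr_wpDl // mulr_ge0.
  rewrite /S normrZ ger0_norm //.
  apply: (@le_trans _ _ (r * (2 * `|v|))).
    apply: ler_wpM2l => //; apply: le_trans (ler_normB _ _) _.
    by rewrite mulr_natl mulr2n lerD2l; exact: sqrt_limit_contract.
  by rewrite mulrA ler_wpM2r // lerDl.
exists S; split=> //.
- move=> u v; rewrite /S.
  rewrite !(sesquiDl hs, sesquiDr hs, sesquiNl hs, sesquiNr hs, sesquiZl hs, sesquiZr hs) rr.
  by rewrite (sqrt_limit_selfadjoint Xl Xc Xa).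
- apply/funext => v /=; rewrite /S.
  rewrite (op_Z Yl) (op_sub Yl) -scalerBr scalerA rM.
  have e : Y v + Y v = X v + Y (Y v).
    have := congr1 (fun w => 2 *: w) (sqrt_limit_fixpoint Xl Xc v).
    by rewrite scalerA mulfV ?pnatr_eq0 // scale1r => <-; rewrite scaler_nat mulr2n.
  have -> : v - Y v - (Y v - Y (Y v)) = v - X v.
    by rewrite -[X v](addrK (Y (Y v))) -e -addrA -opprD addrA.
  by rewrite /X opprB addrC subrK scalerA divff // scale1r.
- move=> C [Cl Cc] CP; apply/funext => v /=; rewrite /S.
  rewrite (op_Z Cl) (op_sub Cl); congr (_ *: (_ - _)).
  have CX : C \o X = X \o C.
    apply/funext => w /=; rewrite /X (op_sub Cl) (op_Z Cl).
    by have /= -> := congr1 (fun f => f w) CP.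
  by have /= := congr1 (fun f => f v) (sqrt_limit_comm Xl Xc (conj Cl Cc) CX).
Qed.

End PositiveSquareRoot.

(** * Complete positivity from positive forms *)

Section OperatorMatrices.
Variables (R : realType) (E : hilbertType R) (n : nat).

Definition hsum_in (j : 'I_n) (x : E) : hsum E n := fun k => if k == j then x else 0.

Lemma hsum_in_linear j : linear (hsum_in j).
Proof.
move=> c x y; apply/funext => k; rewrite /hsum_in.
rewrite -[RHS]/(c *: (if k == j then x else 0) + (if k == j then y else 0)).
by case: (k == j); rewrite // scaler0 addr0.
Qed.

Lemma hsum_sum (I : Type) (r : seq I) (P : pred I) (f : I -> hsum E n) i :
  (\sum_(k <- r | P k) f k) i = \sum_(k <- r | P k) f k i.
Proof. by apply: (big_morph (fun v : hsum E n => v i)). Qed.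

Lemma hsum_decomp (v : hsum E n) : v = \sum_j hsum_in j (v j).
Proof.
apply/funext => k; rewrite hsum_sum (bigD1 k) //= /hsum_in eqxx big1 ?addr0 //.
by move=> j jk; rewrite eq_sym (negbTE jk).
Qed.

Lemma hsum_dot_inl j x (v : hsum E n) : '[hsum_in j x, v] = '[x, v j].
Proof.
rewrite -[LHS]/(\sum_i '[hsum_in j x i, v i]) (bigD1 j) //= /hsum_in eqxx.
by rewrite big1 ?addr0 // => k kj; rewrite (negbTE kj) linear0l.
Qed.

Lemma hsum_dot_inr j x (v : hsum E n) : '[v, hsum_in j x] = '[v j, x].
Proof. by rewrite hdot_conj hsum_dot_inl -hdot_conj. Qed.

Lemma norm_hsum_in j x : `|hsum_in j x| = `|x|.
Proof.
by apply/eqP; rewrite -(@eqrXn2 _ 2) // !hnormE hsum_dot_inl /hsum_in eqxx.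
Qed.

Definition op_matrix (a : 'I_n -> 'I_n -> E -> E) (v : hsum E n) : hsum E n :=
  fun i => \sum_j a i j (v j).

Lemma op_matrix_bounded a : (forall i j, bounded_op (a i j)) -> bounded_op (op_matrix a).
Proof.
move=> ab.
have ml : linear (op_matrix a).
  move=> c u v; apply/funext => i.
  rewrite -[RHS]/(c *: op_matrix a u i + op_matrix a v i).
  rewrite /op_matrix scaler_sumr -big_split; apply: eq_bigr => j _ /=.
  exact: (ab i j).1.
split=> //; apply/(linear_continuousP ml).
have /choice[M M0] (p : 'I_n * 'I_n) :
    exists m : R[i], 0 < m /\ forall x, `|a p.1 p.2 x| <= m * `|x|.
  have [al ac] := ab p.1 p.2; have [m m0 am] := (linear_continuousP al).1 ac.
  by exists m.
exists (1 + \sum_i \sum_j M (i, j)) => [|v].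
  by rewrite ltr_wpDr // !sumr_ge0 // => i _; rewrite sumr_ge0 // => j _; case: (M0 (i, j)) => /ltW.
apply: le_trans (hsum_norm_le _) _.
apply: (@le_trans _ _ ((\sum_i \sum_j M (i, j)) * `|v|)); last first.
  by rewrite mulrDl mul1r lerDr.
rewrite mulr_suml; apply: ler_sum => i _; rewrite mulr_suml.
apply: le_trans (ler_norm_sum _ _ _) _; apply: ler_sum => j _.
have [m0 am] := M0 (i, j); apply: le_trans (am _) _.
by apply: ler_wpM2l; [exact: ltW|exact: hsum_norm_ge].
Qed.

Definition op_entry (S : hsum E n -> hsum E n) i j : E -> E := fun x => S (hsum_in j x) i.

Lemma op_entry_bounded S i j : bounded_op S -> bounded_op (op_entry S i j).
Proof.
move=> [Sl Sc].
have el : linear (op_entry S i j).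
  by move=> c x y; rewrite /op_entry hsum_in_linear Sl.
split=> //; apply/(linear_continuousP el).
have [m m0 Sm] := (linear_continuousP Sl).1 Sc; exists m => // x.
rewrite -(norm_hsum_in j x); apply: le_trans (hsum_norm_ge (S (hsum_in j x)) i) _.
exact: Sm.
Qed.

End OperatorMatrices.

Section BicommutantSqrt.
Variables (R : realType) (E : hilbertType R) (n : nat).

(** The diagonal operators with entry in the commutant of A commute with the
    operator matrix [a], hence with its square root; so the entries of the root
    belong to the bicommutant of A. *)
Lemma op_matrix_sqrt (A : set (E -> E)) (a : 'I_n -> 'I_n -> E -> E) :
  commutant (commutant A) = A ->
  (forall i j, A (a i j)) ->
  (forall v : hsum E n, 0 <= \sum_i \sum_j '[a i j (v j), v i]) ->
  exists c : 'I_n -> 'I_n -> E -> E,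
    [/\ forall i j, A (c i j), forall i j, is_adjoint (c i j) (c j i) &
        forall i j x, a i j x = \sum_k c i k (c k j x)].
Proof.
move=> AA Aa a0.
have bdA T : A T -> bounded_op T by rewrite -AA => -[].
have Pb : bounded_op (op_matrix a) by apply: op_matrix_bounded => i j; exact/bdA/Aa.
have Pp : positive_op (op_matrix a).
  move=> v; rewrite [leRHS](_ : _ = \sum_i \sum_j '[a i j (v j), v i]) //.
  rewrite -[LHS]/(\sum_i '[\sum_j a i j (v j), v i]); apply: eq_bigr => i _.
  exact: (sesqui_suml (hdot_sesqui E)).
have [S [Sb Sa SS Scomm]] := positive_op_sqrt Pb Pp.
have [Sl _] := Sb.
exists (op_entry S); split.
- move=> i j; rewrite -AA; split; first exact: op_entry_bounded.
  move=> C [[Cl Cc] CA].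
  (* the diagonal operator with entry C *)
  pose dC : hsum E n -> hsum E n := fun v k => C (v k).
  have dCb : bounded_op dC.
    have -> : dC = op_matrix (fun i j => if i == j then C else fun=> 0).
      apply/funext => v; apply/funext => k.
      rewrite /op_matrix (bigD1 k) //= eqxx big1 ?addr0 // => l lk.
      by rewrite eq_sym (negbTE lk).
    apply: op_matrix_bounded => k l; case: (k == l); first by split.
    split; last exact: cst_continuous.
    by move=> c x y; rewrite scaler0 addr0.
  have dCP : dC \o op_matrix a = op_matrix a \o dC.
    apply/funext => v; apply/funext => k /=; rewrite /dC /op_matrix (op_sum Cl).
    by apply: eq_bigr => l _; have /= := congr1 (fun f => f (v l)) (CA _ (Aa k l)).
  have := Scomm _ dCb dCP => dCS.
  apply/funext => x /=; rewrite /op_entry.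
  have -> : hsum_in j (C x) = dC (hsum_in j x).
    by apply/funext => k; rewrite /dC /hsum_in; case: (k == j); rewrite // op_0.
  by have /= <- := congr1 (fun f => f (hsum_in j x)) dCS.
- move=> i j x y; rewrite /op_entry.
  by rewrite -[LHS](hsum_dot_inr i y) Sa hsum_dot_inl.
move=> i j x.
have -> : a i j x = op_matrix a (hsum_in j x) i.
  rewrite /op_matrix (bigD1 j) //= /hsum_in eqxx big1 ?addr0 // => k kj.
  by rewrite (negbTE kj) op_0 //; exact: (bdA _ (Aa i k)).1.
rewrite -SS /= [in LHS](hsum_decomp (S (hsum_in j x))) (op_sum Sl) hsum_sum.
by [].
Qed.

End BicommutantSqrt.

Section CPCriterion.
Variables (R : realType) (H K : hilbertType R).
Variables (M : vnAlgebra H) (N : vnAlgebra K) (L : standardForm N).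

(** A matrix [b^* b] is the sum over k of the rank-one matrices
    [(b k i)^* (b k j)], so positivity for rows b is enough; the square root of
    the operator matrix then provides the factor required in N. *)
Lemma CP_criterion (D : M -> N) : linear D ->
  (forall n (b : 'I_n -> M) (xi : 'I_n -> L2 L),
    0 <= \sum_i \sum_j '[L2_rep L (D (vn_mul (vn_star (b i)) (b j))) (xi j), xi i]) ->
  CP D.
Proof.
move=> Dl Dp; split=> // n a [b ab].
have Rl := @L2_rep_linear _ _ _ L.
pose p i j := L2_rep L (D (a i j)).
have [||c [cR cadj cE]] := op_matrix_sqrt (a := p) (@L2_rep_bicommutant _ _ _ L).
- by move=> i j; exists (D (a i j)).
- move=> v; rewrite [leRHS](_ : _ = \sum_k \sum_i \sum_j
      '[L2_rep L (D (vn_mul (vn_star (b k i)) (b k j))) (v j), v i]).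
    by apply: sumr_ge0 => k _; exact: Dp.
  rewrite [RHS]exchange_big; apply: eq_bigr => i _; rewrite [RHS]exchange_big; apply: eq_bigr => j _.
  rewrite /p ab (op_sum Dl) (op_sum Rl) fct_sumE.
  exact: (sesqui_suml (hdot_sesqui _)).
have /choice[d dE] (q : 'I_n * 'I_n) : exists d : N, L2_rep L d = c q.1 q.2.
  by have [d _ <-] := cR q.1 q.2; exists d.
exists (\matrix_(i, j) d (i, j)) => i j; rewrite mxE.
apply: (@L2_rep_inj _ _ _ L); rewrite (op_sum Rl); apply/funext => x.
rewrite fct_sumE -/(p i j) cE; apply: eq_bigr => k _.
rewrite !mxE L2_rep_mul /= dE /=; apply: hdot_inj => w.
by rewrite -cadj -L2_rep_star dE.
Qed.

End CPCriterion.

(** * Spectral measures and quadratic forms *)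

Lemma quadrant_measurable (R : realType) : measurable (@quadrant R).
Proof.
have -> : @quadrant R = (setT `&` [set p | 0 <= p.1]) `&` (setT `&` [set p | 0 <= p.2]).
  by rewrite !setTI; apply/seteqP; split=> p.
by apply: measurableI; apply: measurable_fun_le => //; exact: measurable_cst.
Qed.

Section SpectralMeasure.
Variables (R : realType) (H : hilbertType R) (E : spectralMeasure H).
Implicit Types (S : set (R * R)) (x y : H) (T : H -> H).

(** The quadratic forms of interest take real values; having them in R gives
    access to the arithmetic of an ordered field. *)
Definition quad T x : R := complex.Re '[T x, x].

Lemma spm_linear S : measurable S -> linear (E S).
Proof. by move=> mS; case: (spm_bounded E mS). Qed.

Lemma spm_idem S x : measurable S -> E S (E S x) = E S x.
Proof. by move=> mS; have /= := congr1 (fun f => f x) (spm_setI E mS mS); rewrite setIid => <-. Qed.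

Lemma spm_dot S x y : measurable S -> '[E S x, E S y] = '[E S x, y].
Proof. by move=> mS; rewrite (spm_selfadjoint E mS) spm_idem // -spm_selfadjoint. Qed.

Lemma spm_real S x : measurable S -> '[E S x, x] = (quad (E S) x)%:C.
Proof.
by move=> mS; rewrite /quad -spm_dot // RRe_real //; apply: ger0_real; exact: hdot_ge0.
Qed.

(** [E set0] is a projection whose scalar measures vanish. *)
Lemma spm_set0 x : E set0 x = 0.
Proof.
apply/normr0_eq0/eqP; rewrite -sqrf_eq0 hnormE spm_dot // spm_real //.
have := spm_measureE E x measurable0; rewrite measure0 => -[] e.
by rewrite /quad -e.
Qed.

Lemma spm_disjoint S S' x : measurable S -> measurable S' -> S `&` S' = set0 ->
  E S (E S' x) = 0.
Proof.
move=> mS mS' SS'; have /= <- := congr1 (fun f => f x) (spm_setI E mS mS').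
by rewrite SS' spm_set0.
Qed.

(** The squared norm of the difference of both sides expands into values of
    the scalar measures, which are additive. *)
Lemma spm_setU S S' x : measurable S -> measurable S' -> S `&` S' = set0 ->
  E (S `|` S') x = E S x + E S' x.
Proof.
move=> mS mS' SS'; have mU := measurableU _ _ mS mS'.
have hs := hdot_sesqui H.
apply/subr0_eq/normr0_eq0/eqP; rewrite -sqrf_eq0 hnormE.
have sub V : measurable V -> V `<=` S `|` S' -> '[E (S `|` S') x, E V x] = '[E V x, x].
  move=> mV VU; rewrite hdot_conj (spm_selfadjoint E mV).
  have /= <- := congr1 (fun f => f x) (spm_setI E mV mU).
  by rewrite setIidl // -hdot_conj (spm_selfadjoint E mV).
have sub' V : measurable V -> V `<=` S `|` S' -> '[E V x, E (S `|` S') x] = '[E V x, x].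
  by move=> mV VU; rewrite hdot_conj sub // spm_real // conjc_real.
have o : '[E S x, E S' x] = 0 by rewrite (spm_selfadjoint E mS) spm_disjoint // linear0r.
have o' : '[E S' x, E S x] = 0 by rewrite hdot_conj o conjc0.
rewrite !(sesquiDl hs, sesquiDr hs, sesquiNl hs, sesquiNr hs) !sub ?sub' //;
  try by [left|right|apply: subsetUl|apply: subsetUr].
rewrite o o' (spm_dot _ _ mS) (spm_dot _ _ mS').
have -> : '[E (S `|` S') x, x] = '[E S x, x] + '[E S' x, x].
  rewrite !spm_real // -rmorphD; congr (_%:C).
  have : spm_measure E x (S `|` S') = (spm_measure E x S + spm_measure E x S')%E by exact: measureU.
  by rewrite !spm_measureE // => -[].
by apply/eqP; ring.
Qed.

Lemma spectral_integral_quad f T x : spectral_integral E f T ->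
  quad T x = \int[spm_measure E x]_(p in @quadrant R) f p.
Proof. by move=> [_ /(_ x)[_ e]]; rewrite /quad e. Qed.

Lemma spectral_integral_lincomb f g A B (a b : R) :
  spectral_integral E f A -> spectral_integral E g B ->
  spectral_integral E (fun p => a * f p + b * g p) (fun x => a%:C *: A x + b%:C *: B x).
Proof.
move=> [[Al Ac] fA] [[Bl Bc] gB]; split.
  split.
    move=> c x y; rewrite Al Bl !scalerDr !scalerA [c * a%:C]mulrC [c * b%:C]mulrC.
    by rewrite addrACA.
  by move=> x; apply: cvgD; apply: cvgZr; [exact: Ac|exact: Bc].
move=> x; have [fi Ax] := fA x; have [gi Bx] := gB x.
have afi : (spm_measure E x).-integrable (@quadrant R) (EFin \o (fun p => a * f p)).
  rewrite (_ : _ \o _ = fun p => (a%:E * (EFin \o f) p)%E); last by apply/funext => p; rewrite /= EFinM.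
  exact: (integrableZl (@quadrant_measurable R) a fi).
have bgi : (spm_measure E x).-integrable (@quadrant R) (EFin \o (fun p => b * g p)).
  rewrite (_ : _ \o _ = fun p => (b%:E * (EFin \o g) p)%E); last by apply/funext => p; rewrite /= EFinM.
  exact: (integrableZl (@quadrant_measurable R) b gi).
split.
  rewrite (_ : _ \o _ = (EFin \o (fun p => a * f p)) \+ (EFin \o (fun p => b * g p))).
    exact: (integrableD (@quadrant_measurable R) afi bgi).
  by apply/funext => p; rewrite /= EFinD.
rewrite RintegralD ?RintegralZl //; try exact: quadrant_measurable.
by rewrite linearDl !linearZl_LR /= Ax Bx rmorphD !rmorphM.
Qed.

Lemma quad_lincomb A B (a b : R) x :
  quad (fun x => a%:C *: A x + b%:C *: B x) x = a * quad A x + b * quad B x.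
Proof.
rewrite /quad linearDl !linearZl_LR /=; case: '[A x, x] => ? ?; case: '[B x, x] => ? ? /=.
by rewrite !mul0r !subr0.
Qed.

(** The scalar measure of [E S x] is concentrated on S. *)
Lemma quad_localized f T S x : spectral_integral E f T -> measurable S ->
  (forall p, quadrant p -> S p -> 0 <= f p) -> 0 <= quad T (E S x).
Proof.
move=> fT mS f0; rewrite (spectral_integral_quad _ fT).
have [fi _] := fT.2 (E S x).
rewrite /Rintegral fine_ge0 // (negligible_integral (measurableC mS)) //.
- apply: integral_ge0 => p [Qp /=]; rewrite lee_fin => /contrapT; exact: f0.
- exact: quadrant_measurable.
rewrite spm_measureE; last exact: measurableC.
by rewrite spm_disjoint ?setICl ?linear0l //; exact: measurableC.
Qed.

(** For disjoint sets the scalar measure of a sum of vectors is the sum of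
    the scalar measures, so the quadratic form of T is additive on them and
    polarisation applies. *)
Lemma spectral_integral_ortho f T S S' x y : spectral_integral E f T ->
  measurable S -> measurable S' -> S `&` S' = set0 -> '[T (E S x), E S' y] = 0.
Proof.
move=> fT mS mS' SS'; have [[Tl _] fTi] := fT.
apply: (sesqui_ortho (op_sesqui Tl)) => c; rewrite -(op_Z (spm_linear mS')).
set z := c *: y; set u := E S x; set v := E S' z.
have [ui ue] := fTi u; have [vi ve] := fTi v; have [uvi uve] := fTi (u + v).
rewrite ue ve uve -rmorphD; congr (_%:C).
rewrite /Rintegral (@eq_measure_integral _ _ _ _ (measure_add (spm_measure E u) (spm_measure E v))).
  rewrite integral_measure_add //; last exact: quadrant_measurable.
  by rewrite fineD //; apply: integrable_fin_num => //; exact: quadrant_measurable.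
move=> V mV _; transitivity (spm_measure E u V + spm_measure E v V)%E; last first.
  by apply/esym; exact: measure_addE.
rewrite !spm_measureE // -EFinD; congr (_%:E).
have -> : '[E V (u + v), u + v] = '[E V u, u] + '[E V v, v] + ('[E V u, v] + '[E V v, u]).
  exact: (sesqui_diagD (op_sesqui (spm_linear mV))).
have o : '[E V u, v] = 0.
  rewrite /u; have /= <- := congr1 (fun f => f x) (spm_setI E mV mS).
  rewrite spm_selfadjoint ?spm_disjoint ?linear0r //; try exact: measurableI.
  by rewrite -setIA SS' setI0.
have o' : '[E V v, u] = 0.
  by rewrite (spm_selfadjoint E mV) hdot_conj o conjc0.
by rewrite o o' !addr0 raddfD.
Qed.

End SpectralMeasure.

(** * Sectors of the quadrant and the variational principle *)

Section Sectors.
Variables (R : realType) (n : nat).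

(** The part of the quadrant where [s / (r + s) >= j / n], written without
    division so that the origin lies in every nonempty cut; the bound on j makes
    the cuts end with the empty set after n + 1 steps. *)
Definition cut (j : nat) : set (R * R) :=
  [set p | quadrant p /\ (j <= n)%N /\ j%:R * (p.1 + p.2) <= n%:R * p.2].

Definition sector j := cut j `\` cut j.+1.

Lemma cut_measurable j : measurable (cut j).
Proof.
have [jn|jn] := leqP j n; last first.
  rewrite (_ : cut j = set0) //; apply/seteqP; split=> // p [_ []].
  by rewrite leqNgt jn.
rewrite (_ : cut j = @quadrant R `&` (setT `&` [set p | j%:R * (p.1 + p.2) <= n%:R * p.2])).
  apply: measurableI; first exact: quadrant_measurable.
  apply: measurable_fun_le => //; apply: measurable_funM => //.
  exact: measurable_funD.
by rewrite setTI; apply/seteqP; split=> p /=; rewrite /cut /=; tauto.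
Qed.

Lemma sector_measurable j : measurable (sector j).
Proof. by apply: measurableD; exact: cut_measurable. Qed.

Lemma cut_decreasing j : cut j.+1 `<=` cut j.
Proof.
move=> p [[p1 p2] [jn jp]]; split=> //; split; first exact: ltnW.
apply: le_trans jp; apply: ler_wpM2r; first exact: addr_ge0.
by rewrite ler_nat.
Qed.

Lemma cut_decreasing_le i j : (i <= j)%N -> cut j `<=` cut i.
Proof.
move=> /subnK <-; elim: (j - i)%N => [|k IH] //.
by rewrite addSn; apply: subset_trans IH; exact: cut_decreasing.
Qed.

Lemma cut0 : cut 0 = @quadrant R.
Proof.
apply/seteqP; split=> [p []//|p [p1 p2]]; split=> //; split=> //.
by rewrite mul0r mulr_ge0.
Qed.

Lemma cutS : cut n.+1 = set0.
Proof. by apply/seteqP; split=> // p [_ []]; rewrite ltnn. Qed.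

Lemma sector_disjoint i j : i != j -> sector i `&` sector j = set0.
Proof.
wlog ij : i j / (i < j)%N.
  move=> h ne; have [ij|ji|e] := ltngtP i j; first exact: h.
    by rewrite setIC; apply: h => //; rewrite eq_sym.
  by rewrite e eqxx in ne.
move=> _; apply/seteqP; split=> // p [[_ ni] [cj _]]; apply: ni.
exact: cut_decreasing_le cj.
Qed.

Lemma sector_bounds j p : sector j p ->
  [/\ 0 <= p.1, 0 <= p.2, (j <= n)%N, j%:R * (p.1 + p.2) <= n%:R * p.2 &
      n%:R * p.2 <= j.+1%:R * (p.1 + p.2)].
Proof.
move=> [[[p1 p2] [jn jp]] nc]; split=> //; have s0 := addr_ge0 p1 p2.
move: jn; rewrite leq_eqVlt => /orP[/eqP jn|jn].
  rewrite jn; apply: (@le_trans _ _ (n%:R * (p.1 + p.2))).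
    by apply: ler_wpM2l => //; rewrite lerDr.
  by apply: ler_wpM2r => //; rewrite ler_nat.
by apply/ltW; rewrite ltNge; apply/negP => h; apply: nc; split.
Qed.

Variables (H : hilbertType R) (E : spectralMeasure H).
Hypothesis EQ : E (@quadrant R) = idfun.

(** The projections of the sectors telescope from the quadrant to the empty
    set. *)
Lemma sector_sum x : \sum_(j < n.+1) E (sector j) x = x.
Proof.
transitivity (\sum_(0 <= j < n.+1) (E (cut j) x - E (cut j.+1) x)).
  rewrite big_mkord; apply: eq_bigr => j _.
  have e : cut j = sector j `|` cut j.+1.
    by rewrite /sector setUC setDUK //; exact: cut_decreasing.
  rewrite [in RHS]e spm_setU ?addrK //; [exact: sector_measurable|exact: cut_measurable|].
  by rewrite setIC setDIK.
under eq_bigr do rewrite -opprB.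
by rewrite sumrN telescope_sumr // opprB cut0 cutS spm_set0 subr0 EQ.
Qed.

Lemma quad_sector_sum f T (y : 'I_n.+1 -> H) : spectral_integral E f T ->
  quad T (\sum_(j < n.+1) E (sector j) (y j)) = \sum_(j < n.+1) quad T (E (sector j) (y j)).
Proof.
move=> fT; have [[Tl _] _] := fT.
rewrite /quad (sesqui_suml (op_sesqui Tl)) raddf_sum; apply: eq_bigr => i _.
rewrite (sesqui_sumr (op_sesqui Tl)) (bigD1 i) //= big1 ?addr0 // => j ji.
apply: (spectral_integral_ortho _ _ fT); [exact: sector_measurable..|].
by apply: sector_disjoint; rewrite eq_sym.
Qed.

End Sectors.

Section QuadraticForms.
Variables (R : realType) (H : hilbertType R) (E : spectralMeasure H).

Lemma quad_scale T (c : R) (v : H) : linear T -> quad T (c%:C *: v) = c ^+ 2 * quad T v.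
Proof.
move=> Tl; have Ts := op_sesqui Tl.
rewrite /quad (sesquiZl Ts) (sesquiZr Ts) conjc_real; case: '[T v, v] => a b /=.
by ring.
Qed.

(** For [a = 1 - c] and [b = - c] the right-hand side is
    [(1 - c) q u + c q v - c (1 - c) q (u + v)], whose nonnegativity is the
    convexity bound behind [parallel_le]. *)
Lemma quad_comb T (a b : R) (u v : H) : linear T ->
  quad T (a%:C *: u + b%:C *: v) =
  a ^+ 2 * quad T u + b ^+ 2 * quad T v + a * b * (quad T (u + v) - quad T u - quad T v).
Proof.
move=> Tl; have Ts := op_sesqui Tl.
rewrite /quad !(sesqui_diagD Ts) !(sesquiZl Ts, sesquiZr Ts) !conjc_real.
case: '[T u, u] => ? ?; case: '[T v, v] => ? ?; case: '[T u, v] => ? ?; case: '[T v, u] => ? ? /=.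
by ring.
Qed.

Lemma quad_localized3 f g h A B T S x (t a b : R) :
  spectral_integral E h T -> spectral_integral E f A -> spectral_integral E g B ->
  measurable S -> (forall p, quadrant p -> S p -> 0 <= t * h p + a * f p + b * g p) ->
  0 <= t * quad T (E S x) + a * quad A (E S x) + b * quad B (E S x).
Proof.
move=> hT fA gB mS pos.
have := spectral_integral_lincomb 1 b (spectral_integral_lincomb t a hT fA) gB.
have pos' p : quadrant p -> S p -> 0 <= 1 * (t * h p + a * f p) + b * g p.
  by move=> Qp Sp; rewrite mul1r; exact: pos.
by move=> /(@quad_localized _ _ _ _ _ _ x) /(_ mS pos'); rewrite !quad_lincomb mul1r.
Qed.

End QuadraticForms.

Lemma le_archimedean (R : realType) (x y k : R) :
  (forall n, x <= y + n.+1%:R^-1 * k) -> x <= y.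
Proof.
move=> h; apply/ler_addgt0Pr => e e0.
have [k0|k0] := leP k 0.
  apply: le_trans (h 0) _; apply: lerD => //; rewrite invr1 mul1r.
  exact: le_trans k0 (ltW e0).
have [n ne] : exists n : nat, k / e < n%:R.
  by exists (Num.bound (k / e)); apply: archi_boundP; rewrite divr_ge0 // ltW.
apply: le_trans (h n) _; rewrite lerD2l mulrC ler_pdivrMr //.
rewrite ltr_pdivrMr // in ne; apply/ltW; apply: lt_le_trans ne _.
by rewrite mulrC ler_pM2l // ler_nat.
Qed.

Section ScalarInequalities.
Variable R : realType.
Implicit Types p : R * R.

Lemma geometric_le_mean p : quadrant p -> 2 * geometric_fun p <= p.1 + p.2.
Proof.
move=> [p1 p2]; rewrite /geometric_fun sqrtrM //.
have := sqr_ge0 (Num.sqrt p.1 - Num.sqrt p.2).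
rewrite sqrrB !sqr_sqrtr // -mulr_natl => ?; lra.
Qed.

(** The number [a] is the ratio s/(r+s); at the origin, where it is
    undetermined, any value allowed by the sector will do. *)
Lemma sector_ratio n j p : sector n.+1 j p -> exists a : R,
  [/\ p.1 = (1 - a) * (p.1 + p.2), p.2 = a * (p.1 + p.2), 0 <= a <= 1,
      parallel_fun p = a * (1 - a) * (p.1 + p.2) &
      j%:R / n.+1%:R <= a <= j%:R / n.+1%:R + n.+1%:R^-1].
Proof.
move=> /sector_bounds; case: p => r s /= [r0 s0 jn lo hi].
rewrite /parallel_fun /=.
set m : R := n.+1%:R in lo hi *; have m0 : 0 < m by rewrite ltr0n.
have [w0|w0] := eqVneq (r + s) 0.
  have [-> ->] : r = 0 /\ s = 0 by split; lra.
  exists (j%:R / m); rewrite !(mulr0, mul0r, addr0) lexx lerDl invr_ge0 (ltW m0); split=> //.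
  by rewrite divr_ge0 ?(ltW m0) //= ler_pdivrMr // mul1r ler_nat.
have wp : 0 < r + s by rewrite lt_def w0 addr_ge0.
exists (s / (r + s)); split.
- by field.
- by field.
- by rewrite divr_ge0 ?(ltW wp) //= ler_pdivrMr // mul1r lerDr.
- by field.
have -> : j%:R / m + m^-1 = j.+1%:R / m by rewrite -natr1 mulrDl mul1r.
apply/andP; split.
  by rewrite ler_pdivrMr // mulrAC ler_pdivlMr // [s * m]mulrC.
by rewrite ler_pdivlMr // mulrAC ler_pdivrMr // mulrC.
Qed.

Lemma parallel_le_geometric p : quadrant p -> 2 * parallel_fun p <= geometric_fun p.
Proof.
move=> Qp; have := geometric_le_mean Qp; case: p Qp => r s [/= r0 s0].
rewrite /geometric_fun /parallel_fun /=.
set g := Num.sqrt (r * s); have g0 : 0 <= g by exact: sqrtr_ge0.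
have gg : g ^+ 2 = r * s by rewrite sqr_sqrtr // mulr_ge0.
move=> gw; have [w0|w0] := eqVneq (r + s) 0; first by rewrite w0 invr0 !mulr0.
have wp : 0 < r + s by rewrite lt_def w0 addr_ge0.
rewrite mulrA ler_pdivrMr // -gg expr2 mulrCA.
by apply: ler_wpM2l.
Qed.

(** [c^2 r + (1 - c)^2 s = r s / (r + s) + (a - c)^2 (r + s)], where a is the
    ratio s/(r+s), and [|a - c| <= d]. *)
Lemma sector_split n j p : sector n.+1 j p ->
  let c := j%:R / n.+1%:R in let d := n.+1%:R^-1 in
  c ^+ 2 * p.1 + (1 - c) ^+ 2 * p.2 <= 2^-1 * geometric_fun p + d * (p.1 + p.2).
Proof.
move=> sp /=; have [p1 p2 _ _ _] := sector_bounds sp.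
have := @parallel_le_geometric p (conj p1 p2).
have [a [e1 e2 /andP[a0 a1] -> /andP[ca ad]]] := sector_ratio sp.
move: ca ad; set c := j%:R / _; set d := n.+1%:R^-1 => ca ad.
have d1 : 0 <= d <= 1 by rewrite invr_ge0 ler0n /= invf_le1 ?ltr0n // ler1n.
have w0 : 0 <= p.1 + p.2 by exact: addr_ge0.
have -> : c ^+ 2 * p.1 + (1 - c) ^+ 2 * p.2 =
    c ^+ 2 * ((1 - a) * (p.1 + p.2)) + (1 - c) ^+ 2 * (a * (p.1 + p.2)).
  by rewrite -e1 -e2.
move: (p.1 + p.2) w0 => w w0.
have -> : c ^+ 2 * ((1 - a) * w) + (1 - c) ^+ 2 * (a * w) =
    a * (1 - a) * w + (a - c) ^+ 2 * w by ring.
have : (a - c) ^+ 2 * w <= d * w.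
  apply: ler_wpM2r => //; case/andP: d1 => d0 d1; nra.
move: ((a - c) ^+ 2 * w) (a * (1 - a) * w) (d * w) (geometric_fun p) => ? ? ? ?; lra.
Qed.

(** The three functions are [1 - a], [a] and [a (1 - a)] times [r + s], with
    a within d of c. *)
Lemma sector_parallel n j p : sector n.+1 j p ->
  let c := j%:R / n.+1%:R in let d := n.+1%:R^-1 in
  [/\ (1 - c - d) * (p.1 + p.2) <= p.1, c * (p.1 + p.2) <= p.2 &
      parallel_fun p <= (c * (1 - c) + d) * (p.1 + p.2)].
Proof.
move=> sp /=; have [p1 p2 _ _ _] := sector_bounds sp.
have [a [e1 e2 /andP[a0 a1] -> /andP[ca ad]]] := sector_ratio sp.
move: ca ad; set c := j%:R / _; set d := n.+1%:R^-1 => ca ad.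
have c0 : 0 <= c by rewrite divr_ge0 ?ler0n.
have w0 : 0 <= p.1 + p.2 by exact: addr_ge0.
split; [rewrite [leRHS]e1|rewrite [leRHS]e2|]; apply: ler_wpM2r => //.
- by lra.
- by nra.
Qed.

End ScalarInequalities.

Section Variational.
Variables (R : realType) (H : hilbertType R) (A B T : H -> H).

(** The vector y is the sum of [c_j E(S_j) x], where [c_j = j / (n + 1)] is
    the value of s/(r+s) on the j-th sector, up to [1 / (n + 1)]. *)
Lemma geometric_split : joint_calculus (@geometric_fun R) A B T ->
  forall x n, exists y, quad A y + quad B (x - y) <=
    2^-1 * quad T x + n.+1%:R^-1 * (quad A x + quad B x).
Proof.
move=> [E [EQ hA hB hT]] x n.
have [[Al _] _] := hA; have [[Bl _] _] := hB.
pose c (j : 'I_n.+2) : R := j%:R / n.+1%:R.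
pose e (j : 'I_n.+2) := E (sector n.+1 j) x.
have El j := spm_linear E (@sector_measurable R n.+1 j).
have xE := sector_sum n.+1 EQ x.
exists (\sum_(j < n.+2) E (sector n.+1 j) ((c j)%:C *: x)).
have -> : x - \sum_(j < n.+2) E (sector n.+1 j) ((c j)%:C *: x) =
    \sum_(j < n.+2) E (sector n.+1 j) ((1 - c j)%:C *: x).
  rewrite -[X in X - _]xE -sumrB; apply: eq_bigr => j _.
  by rewrite !(op_Z (El j)) rmorphB scalerBl scale1r.
rewrite -[in leRHS]xE !(quad_sector_sum _ hA, quad_sector_sum _ hB, quad_sector_sum _ hT).
rewrite mulr_sumr -!big_split /= mulr_sumr -big_split /=; apply: ler_sum => j _.
rewrite !(op_Z (El j)) !quad_scale //.
set d : R := n.+1%:R^-1; set k := c j.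
have := quad_localized3 (t := 2^-1) (a := d - k ^+ 2) (b := d - (1 - k) ^+ 2) x
  hT hA hB (@sector_measurable R n.+1 j).
set qA := quad A _; set qB := quad B _; set qT := quad T _ => h.
have {}h : 0 <= 2^-1 * qT + (d - k ^+ 2) * qA + (d - (1 - k) ^+ 2) * qB.
  apply: h => p _ Sp; have := sector_split Sp; rewrite -/d -/(c j) -/k /=.
  by lra.
by lra.
Qed.

(** On the j-th sector, with components u and v of y and z and with W = A + B,
    the operators A, B and T are close to [(1 - c) W], [c W] and
    [c (1 - c) W], and the inequality for these follows from positivity of W at
    [(1 - c) u - c v]. *)
Lemma parallel_le : positive_op A -> positive_op B ->
  joint_calculus (@parallel_fun R) A B T ->
  forall y z, quad T (y + z) <= quad A y + quad B z.
Proof.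
move=> A0 B0 [E [EQ hA hB hT]] y z.
have [[Al _] _] := hA; have [[Bl _] _] := hB.
apply: (@le_archimedean _ _ _ (quad A (y + z) + quad B (y + z) + (quad A y + quad B y))).
move=> n.
have El j := spm_linear E (@sector_measurable R n.+1 j).
pose u j := E (sector n.+1 j) y; pose v j := E (sector n.+1 j) z.
have uvE j : E (sector n.+1 j) (y + z) = u j + v j by rewrite (op_D (El j)).
have quadE f S : spectral_integral E f S ->
  [/\ quad S y = \sum_(j < n.+2) quad S (u j), quad S z = \sum_(j < n.+2) quad S (v j) &
      quad S (y + z) = \sum_(j < n.+2) quad S (u j + v j)].
  move=> hS; rewrite -[in quad S y = _](sector_sum n.+1 EQ y).
  rewrite -[in quad S z = _](sector_sum n.+1 EQ z) -[in quad S (y + z) = _](sector_sum n.+1 EQ (y + z)).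
  rewrite !(quad_sector_sum _ hS); split=> //.
  by apply: eq_bigr => j _; rewrite uvE.
have [Ay _ Ax] := quadE _ _ hA; have [By Bz Bx] := quadE _ _ hB; have [_ _ Tx] := quadE _ _ hT.
rewrite Ay Ax By Bz Bx Tx -!big_split /= mulr_sumr -big_split /=; apply: ler_sum => j _.
set c : R := j%:R / n.+1%:R; set d : R := n.+1%:R^-1.
have loc x t a b := @quad_localized3 _ _ E _ _ _ A B T (sector n.+1 j) x t a b hT hA hB (@sector_measurable R n.+1 j).
have quad_ge0 (S : H -> H) w : positive_op S -> 0 <= quad S w.
  by move=> /(_ w); rewrite lecE => /andP[].
have h1 : 0 <= 0 * quad T (u j) + (c + d) * quad A (u j) + (c + d - 1) * quad B (u j).
  apply: loc => p _ /sector_parallel [+ _ _]; rewrite -/c -/d => ?; lra.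
have h2 : 0 <= 0 * quad T (v j) + (- c) * quad A (v j) + (1 - c) * quad B (v j).
  apply: loc => p _ /sector_parallel [_ + _]; rewrite -/c -/d => ?; lra.
have h3 : 0 <= (-1) * quad T (u j + v j) + (c * (1 - c) + d) * quad A (u j + v j) +
    (c * (1 - c) + d) * quad B (u j + v j).
  by rewrite -uvE; apply: loc => p _ /sector_parallel [_ _ +]; rewrite -/c -/d => ?; lra.
have h4 := quad_ge0 A ((1 - c)%:C *: u j + (- c)%:C *: v j) A0.
have h5 := quad_ge0 B ((1 - c)%:C *: u j + (- c)%:C *: v j) B0.
rewrite !quad_comb // in h4 h5.
by lra.
Qed.

End Variational.

(** * Comparison of the means *)

Section Density.
Variables (R : realType) (H : hilbertType R).

Lemma quad_near (F : set_system H) {FF : Filter F} (T u : H -> H) y (e : R) :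
  continuous T -> u @ F --> y -> 0 < e -> \forall w \near F, quad T (u w) < quad T y + e.
Proof.
move=> Tc uy e0.
have h : '[T (u w), u w] @[w --> F] --> '[T y, y].
  by apply: hdot_cvg => //; apply: continuous_cvg => //; exact: Tc.
have e0' : 0 < e%:C by rewrite -[0]/((0 : R)%:C) ltcR.
near=> w.
have : `|'[T (u w), u w] - '[T y, y]| < e%:C.
  by near: w; have /cvgrPdistC_lt := h; apply.
move=> /(le_lt_trans (normc_ge_Re _)); rewrite ltcR => /(le_lt_trans (ler_norm _)).
by rewrite raddfB /= ltrBlDl.
Unshelve. all: by end_near. Qed.

(** The left-hand side is continuous in [h v], and the range of h is
    dense. *)
Lemma quad_dense (V : Type) (h : V -> H) A B (x y : H) (e : R) :
  dense (range h) -> continuous A -> continuous B -> 0 < e ->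
  exists v, quad A (h v) + quad B (x - h v) <= quad A y + quad B (x - y) + e.
Proof.
move=> hd Ac Bc e0; have e20 : 0 < e / 2 by rewrite divr_gt0.
have nA : \forall w \near y, quad A w < quad A y + e / 2.
  by apply: (@quad_near (nbhs y) _ A id) => //; exact: cvg_id.
have nB : \forall w \near y, quad B (x - w) < quad B (x - y) + e / 2.
  apply: (@quad_near (nbhs y) _ B (fun w => x - w)) => //.
  by apply: cvgB; [exact: cvg_cst|exact: cvg_id].
pose near_y := [set w | quad A w < quad A y + e / 2 /\ quad B (x - w) < quad B (x - y) + e / 2].
have y_near : near_y° !=set0 by exists y; exact: filterI nA nB.
have [w [/interior_subset [wA wB] [v _ vw]]] := hd _ y_near (@open_interior _ _).
exists v; rewrite vw; apply: le_trans (ltW (ltrD wA wB)) _; lra.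
Qed.

End Density.

Section FormComparison.
Variables (R : realType) (V : lmodType R[i]).
Implicit Types alpha beta gamma : V -> V -> R[i].

Lemma form_rep_sesqui (H : hilbertType R) (h : V -> H) (T : H -> H) gamma :
  linear h -> linear T -> (forall x y, gamma x y = '[T (h x), h y]) ->
  sesquilinear_form gamma.
Proof.
move=> hl Tl gE; have Ts := op_sesqui Tl.
by split=> c x y z; rewrite !gE hl (sesquiPl Ts, sesquiPr Ts).
Qed.

Lemma form_calculus_sesqui f alpha beta gamma : form_calculus f alpha beta gamma ->
  [/\ sesquilinear_form alpha, sesquilinear_form beta & sesquilinear_form gamma].
Proof.
move=> [H [h [A [B [T [[hl _ [Al _] [Bl _] _ _ _ aE bE] [E [_ _ _ [[Tl _] _]]] gE]]]]]].
by split; [exact: form_rep_sesqui aE|exact: form_rep_sesqui bE|exact: form_rep_sesqui gE].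
Qed.

Lemma spectral_real (H : hilbertType R) (E : spectralMeasure H) f T x :
  spectral_integral E f T -> '[T x, x] = (quad T x)%:C.
Proof. by move=> [_ /(_ x) [_ e]]; rewrite /quad e. Qed.

Lemma positive_real (H : hilbertType R) (T : H -> H) x :
  positive_op T -> '[T x, x] = (quad T x)%:C.
Proof. by move=> /(_ x) T0; rewrite /quad RRe_real // ger0_real. Qed.

Lemma geometric_le_arithmetic_form alpha beta gamma :
  form_geometric_mean alpha beta gamma ->
  forall u, gamma u u <= 2^-1 * (alpha u u + beta u u).
Proof.
move=> [H [h [A [B [T [[_ _ _ _ A0 B0 _ aE bE] [E [EQ hA hB hT]] gE]]]]]] u.
rewrite aE bE gE (spectral_real _ hT) !positive_real // -rmorphD.
have -> : (2^-1 : R[i]) = (2^-1 : R)%:C by rewrite fmorphV rmorph_nat.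
rewrite -rmorphM /= lecR.
have := @quad_localized3 _ _ E _ _ _ A B T setT (h u) (-1) (2^-1) (2^-1) hT hA hB measurableT.
rewrite (spm_setT E) /= => le; suff /le : forall p : R * R, quadrant p -> setT p ->
   0 <= -1 * geometric_fun p + 2^-1 * p.1 + 2^-1 * p.2 by lra.
by move=> p /geometric_le_mean h2 _; lra.
Qed.

(** The values [quad A (h v) + quad B (h u - h v)] are the same in both
    representations, which links the upper bound found in the one to the
    approximate minimiser found in the other. *)
Lemma parallel_le_geometric_form alpha beta gamma delta :
  form_geometric_mean alpha beta gamma -> form_parallel_sum alpha beta delta ->
  forall u, 2 * delta u u <= gamma u u.
Proof.
move=> [H1 [h1 [A1 [B1 [T1 [[h1l h1d [_ A1c] [_ B1c] A10 B10 _ a1E b1E] j1 gE]]]]]].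
move=> [H2 [h2 [A2 [B2 [T2 [[h2l _ _ _ A20 B20 _ a2E b2E] j2 dE]]]]]] u.
have [E1 [_ _ _ hT1]] := j1; have [E2 [_ _ _ hT2]] := j2.
rewrite gE dE (spectral_real _ hT1) (spectral_real _ hT2).
have -> : (2 : R[i]) = (2 : R)%:C by rewrite rmorph_nat.
rewrite -rmorphM lecR mulrC -ler_pdivlMr //.
have qA v : quad A2 (h2 v) = quad A1 (h1 v) by rewrite /quad -a1E a2E.
have qB v : quad B2 (h2 v) = quad B1 (h1 v) by rewrite /quad -b1E b2E.
apply: (@le_archimedean _ _ _ (quad A1 (h1 u) + quad B1 (h1 u))) => n.
have [y yle] := geometric_split j1 (h1 u) n.
apply/ler_addgt0Pr => e e0.
have [v vle] := quad_dense (h1 u) y h1d A1c B1c e0.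
have := parallel_le A20 B20 j2 (h2 v) (h2 (u - v)).
rewrite (op_sub h2l) addrC subrK -(op_sub h2l) qA qB (op_sub h1l).
move: yle vle; rewrite mulrC; move: (_ * (quad A1 _ + quad B1 _)) => k; lra.
Qed.

End FormComparison.

Section CompletelyPositiveOrder.
Variables (R : realType) (H K : hilbertType R).
Variables (M : vnAlgebra H) (N : vnAlgebra K) (L : standardForm N).
Implicit Types Theta Omega : M -> N.
Local Notation MoL := (tensor M (L2 L)).
Implicit Types gamma omega : MoL -> MoL -> R[i].

(** The sum appearing in [CP_criterion] is the form at a single tensor. *)
Lemma represents_sum Theta gamma n (b : 'I_n -> M) (xi : 'I_n -> L2 L) :
  sesquilinear_form gamma -> represents Theta gamma ->
  \sum_i \sum_j '[L2_rep L (Theta (vn_mul (vn_star (b i)) (b j))) (xi j), xi i] =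
  gamma (\sum_j tpure (b j) (xi j)) (\sum_j tpure (b j) (xi j)).
Proof.
move=> gs gT; rewrite (sesqui_sumr gs); apply: eq_bigr => i _.
by rewrite (sesqui_suml gs); apply: eq_bigr => j _; rewrite gT.
Qed.

Lemma cp_le_represents Theta Omega gamma omega :
  linear Theta -> linear Omega ->
  sesquilinear_form gamma -> sesquilinear_form omega ->
  represents Theta gamma -> represents Omega omega ->
  (forall u, gamma u u <= omega u u) -> cp_le Theta Omega.
Proof.
move=> Tl Ol gs os gT oO le; apply: (CP_criterion (L := L)).
  by move=> c x y; rewrite Tl Ol scalerBr opprD addrACA.
move=> n b xi; have Rl := @L2_rep_linear _ _ _ L.
under eq_bigr => i _.
  under eq_bigr => j _ do rewrite (op_sub Rl) linearBl.
  rewrite sumrB; over.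
by rewrite sumrB (represents_sum _ _ os oO) (represents_sum _ _ gs gT) subr_ge0.
Qed.

End CompletelyPositiveOrder.

Theorem theorem3p18 (R : realType) (H K : hilbertType R)
  (M : vnAlgebra H) (N : vnAlgebra K) (L : standardForm N)
  (Phi Psi Geo Har : M -> N) :
  CP Phi -> CP Psi ->
  is_geometric_mean L Phi Psi Geo ->
  is_harmonic_mean L Phi Psi Har ->
  cp_le Har Geo /\ cp_le Geo (cp_arithmetic_mean Phi Psi).
Proof.
move=> [Phil _] [Psil _] [[Geol _] [gamma [gm gG]]] [Pi [[Pil _] [delta [ps dP]]] ->].
have [as_ bs gs] := form_calculus_sesqui gm; have [_ _ ds] := form_calculus_sesqui ps.
split.
- apply: (cp_le_represents (L := L) (gamma := fun u v => 2 * delta u v) (omega := gamma)) => //.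
  + by move=> c x y /=; rewrite Pil scalerDr !scalerA mulrC.
  + by split=> c x y z; rewrite (sesquiPl ds, sesquiPr ds) mulrDr mulrCA.
  + move=> x y xi eta; rewrite -dP (op_Z (@L2_rep_linear _ _ _ L)); exact: linearZl_LR.
  + exact: parallel_le_geometric_form gm ps.
apply: (cp_le_represents (L := L) (gamma := gamma)
  (omega := fun u v => 2^-1 * (cp_form Phi u v + cp_form Psi u v))) => //.
- move=> c x y; rewrite /cp_arithmetic_mean Phil Psil addrACA -scalerDr.
  by rewrite [LHS]scalerDr !scalerA [c * _]mulrC.
- split=> c x y z; rewrite !(sesquiPl as_, sesquiPl bs, sesquiPr as_, sesquiPr bs); ring.
- move=> x y xi eta; have Rl := @L2_rep_linear _ _ _ L.
  rewrite /cp_arithmetic_mean (op_Z Rl) (op_D Rl) !cp_form_pure //.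
  by rewrite linearZl_LR linearDl.
exact: geometric_le_arithmetic_form gm.
Qed.
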